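(* Let $G$ be a discretizable Carnot group with homogeneous dimension $k$ and let $\epsilon>0$. Then there exist a bounded open set $U\subset G$ and a Lipschitz map $F:U\to\mathbf R^k$ such that $H^{k-\epsilon}(F(U))>0$.
   Context: A Carnot group $G$ is a connected, simply connected nilpotent Lie group whose Lie algebra is graded, $\mathfrak g=\bigoplus_{j=1}^d\mathfrak g_j$, with $[\mathfrak g_1,\mathfrak g_j]=\mathfrak g_{j+1}$ and $\mathfrak g_{d+1}=\{0\}$. The Carnot–Carathéodory distance $d_{CC}(g,h)$ is the infimum of $\int_0^1|\gamma'(t)|\,dt$ over curves $\gamma:[0,1]\to G$ from $g$ to $h$ that are horizontal (tangent to the left-invariant distribution determined by $\mathfrak g_1$), where $|\cdot|$ is a fixed Euclidean norm on $\mathfrak g_1$. The homogeneous dimension is $\sum_j j\dim\mathfrak g_j$. $G$ carries the metric $d_{CC}$, $\mathbf R^k$ the Euclidean metric; $H^s$ is $s$-dimensional Hausdorff measure. Discretizable: write $m_j=\dim\mathfrak g_j$. $G$ is discretizable if for $1\le j\le d$ there are elements $X_{(j,1)},\dots,X_{(j,m_j)}\in\mathfrak g_j$ spanning $\mathfrak g_j$ such that, with $g_{(j,i)}=\exp(X_{(j,i)})$, $H_j=\langle g_{(j',i)}: 1\le i\le m_{j'},\ j\le j'\le d\rangle$, $G_j=\langle \exp(\mathfrak g_{j'}): j'\ge j\rangle$ and $G'=\langle g_{(1,i)}:1\le i\le m_1\rangle$, the group $G'$ is a discrete subgroup of $G$ and $G'\cap G_j=H_j$ for all $j$. *)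

(* Defs.v *)
From HB Require Import structures.
From mathcomp Require Import all_boot all_order all_fingroup all_algebra.
From mathcomp Require Import all_classical all_reals all_analysis.

Set Implicit Arguments.
Unset Strict Implicit.
Unset Printing Implicit Defensive.

Import Order.TTheory GRing.Theory Num.Theory.
Import numFieldNormedType.Exports.

Local Open Scope classical_set_scope.
Local Open Scope ring_scope.

Section LieAlgebra.
Context {R : realType} {n : nat}.
Notation g := 'rV[R]_n.
Implicit Types (br : g -> g -> g) (V W : {vspace g}).

Definition bilinear_map (U : lmodType R) (b : g -> g -> U) : Prop :=
  (forall a x y z, b (a *: x + y) z = a *: b x z + b y z) /\
  (forall a x y z, b z (a *: x + y) = a *: b z x + b z y).

Definition is_lie_bracket br : Prop :=
  [/\ bilinear_map br,
      forall x, br x x = 0 &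
      forall x y z, br x (br y z) + br y (br z x) + br z (br x y) = 0].

(* [V, W] is the span of all [x, y] with x in V and y in W; by bilinearity
   bases suffice. *)
Definition bracketv br V W : {vspace g} :=
  <<[seq br x y | x <- vbasis V, y <- vbasis W]>>%VS.

(* [a1, [a2, ..., [a_(m-1), a_m]]] *)
Fixpoint nested_bracket br (w : seq g) : g :=
  match w with
  | [::] => 0
  | [:: a] => a
  | a :: w' => br a (nested_bracket br w')
  end.

(* Dynkin's form of the Baker-Campbell-Hausdorff series log (e^x e^y),
     sum_(m >= 1) (-1)^(m-1) / m sum_(r_i + s_i > 0)
        [x^r_1 y^s_1 ... x^r_m y^s_m]
          / ((sum_i (r_i + s_i)) prod_i r_i! s_i!),
   with p i = (r_i, s_i). In a Lie algebra that is nilpotent of step d every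
   term with m > d, r_i > d or s_i > d vanishes, so the truncation is exact. *)
Definition bch (d : nat) br (x y : g) : g :=
  \sum_(1 <= m < d.+1) ((-1) ^+ m.-1 / m%:R) *:
    \sum_(p : {ffun 'I_m -> 'I_d.+1 * 'I_d.+1}
            | [forall i, (0 < (p i).1 + (p i).2)%N])
      ((\sum_i ((p i).1 + (p i).2))%N%:R *
       (\prod_i ((p i).1`! * (p i).2`!))%N%:R)^-1 *:
      nested_bracket br
        (flatten [seq nseq (p i).1 x ++ nseq (p i).2 y | i <- enum 'I_m]).

End LieAlgebra.

(* The Lie algebra is given in linear coordinates. A connected, simply connected
   nilpotent Lie group is, up to isomorphism, a group with a bijection exp from
   its Lie algebra for which the product is the Baker-Campbell-Hausdorff product;
   exp is then a global chart and carries the smooth structure. The grading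
   makes the Lie algebra nilpotent of step at most d. *)
Record carnotGroup (R : realType) := CarnotGroup {
  lie_dim : nat;
  step : nat;
  bracket : 'rV[R]_lie_dim -> 'rV[R]_lie_dim -> 'rV[R]_lie_dim;
  layer : nat -> {vspace 'rV[R]_lie_dim};
  carnot_sort :> groupType;
  Exp : 'rV[R]_lie_dim -> carnot_sort;
  Log : carnot_sort -> 'rV[R]_lie_dim;
  inner1 : 'rV[R]_lie_dim -> 'rV[R]_lie_dim -> R^o;
  bracket_lie : is_lie_bracket bracket;
  (* layers are indexed by nat and vanish outside 1, ..., step *)
  layer0 : layer 0 = 0%VS;
  layer_gt_step : forall j, (step < j)%N -> layer j = 0%VS;
  layer_direct : directv (\sum_(i < step) layer i.+1)%VS;
  layer_full : (\sum_(i < step) layer i.+1)%VS = fullv;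
  layer_graded : forall i j x y, x \in layer i -> y \in layer j ->
    bracket x y \in layer (i + j)%N;
  layer_generated : forall j, (1 <= j <= step)%N ->
    bracketv bracket (layer 1) (layer j) = layer j.+1;
  ExpK : cancel Exp Log;
  LogK : cancel Log Exp;
  ExpM : forall x y, (Exp x * Exp y)%g = Exp (bch step bracket x y);
  (* the inner product on layer 1; its values off layer 1 are never used *)
  inner1_bilinear : bilinear_map inner1;
  inner1_sym : forall x y, inner1 x y = inner1 y x;
  inner1_gt0 : forall x, x \in layer 1 -> x != 0 -> 0 < inner1 x x
}.

Section CarnotMetric.
Context {R : realType} (G : carnotGroup R).
Implicit Types (gam : R -> G) (U : set G).

Definition hom_dim : nat := (\sum_(1 <= j < (step G).+1) j * \dim (layer G j))%N.

(* gam'(t), moved to the tangent space at 1 (the Lie algebra) by the left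
   translation by gam(t)^-1 and read in the chart Log, whose differential at 1
   is the identity. *)
Definition velocity gam (t : R) : 'rV[R]_(lie_dim G) :=
  derive1 (fun s => Log ((gam t)^-1 * gam s)%g) t.

Definition C1_curve gam : Prop :=
  (forall t, derivable (fun s => Log ((gam t)^-1 * gam s)%g : 'rV[R]_(lie_dim G))
               t 1) /\
  continuous (velocity gam).

(* C1 on [0,1] is expressed by being the restriction of a C1 curve on R. *)
Definition horizontal gam : Prop :=
  C1_curve gam /\ forall t, 0 <= t <= 1 -> velocity gam t \in layer G 1.

Definition curve_length gam : \bar R :=
  (\int[lebesgue_measure]_(t in `[0%R, 1%R])
     (Num.sqrt (inner1 (velocity gam t) (velocity gam t)))%:E)%E.

Definition cc_dist (a b : G) : \bar R :=
  ereal_inf [set curve_length gam |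
    gam in [set gam | [/\ horizontal gam, gam 0 = a & gam 1 = b]]].

Definition cc_open U : Prop :=
  forall a, U a -> exists2 r : R, 0 < r &
    forall b, (cc_dist a b < r%:E)%E -> U b.

Definition cc_bounded U : Prop :=
  exists M : R, forall a b, U a -> U b -> (cc_dist a b <= M%:E)%E.

Definition is_subgroup (H : set G) : Prop :=
  [/\ H 1%g, forall a b, H a -> H b -> H (a * b)%g &
      forall a, H a -> H (a^-1)%g].

Definition subgroup_generated (A : set G) : set G := smallest is_subgroup A.

Definition cc_discrete (H : set G) : Prop :=
  forall a, H a -> exists2 r : R, 0 < r &
    forall b, H b -> (cc_dist a b < r%:E)%E -> b = a.

Definition discretizable : Prop :=
  exists X : forall j, (\dim (layer G j)).-tuple 'rV[R]_(lie_dim G),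
    let H_ j := subgroup_generated
      [set a | exists j' i, (j <= j' <= step G)%N /\ a = Exp (tnth (X j') i)] in
    let G_ j := subgroup_generated
      [set a | exists j' x, [/\ (j <= j' <= step G)%N, x \in layer G j'
                              & a = Exp x]] in
    let G' := subgroup_generated [set a | exists i, a = Exp (tnth (X 1) i)] in
    [/\ forall j, (1 <= j <= step G)%N -> <<X j>>%VS = layer G j,
        cc_discrete G' &
        forall j, (1 <= j <= step G)%N -> G' `&` G_ j = H_ j].

End CarnotMetric.

Section Euclidean.
Context {R : realType} {k : nat}.
Implicit Types (A : set 'rV[R]_k).

(* The norm that the library puts on 'rV[R]_k is the sup norm. *)
Definition eucl_dist (x y : 'rV[R]_k) : R :=
  Num.sqrt (\sum_i (x ord0 i - y ord0 i) ^+ 2).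

Definition eucl_diam A : \bar R :=
  ereal_sup [set (eucl_dist p.1 p.2)%:E | p in A `*` A].

(* (diam A)^s, as expeR (s * lne (diam A)): for diam A = 0 this is 0, 1, +oo
   according to whether s is positive, zero, negative (powR 0 s is 0 for s < 0). *)
Definition diam_pow (s : R) A : \bar R :=
  if A == set0 then 0%E else expeR (s%:E * lne (eucl_diam A))%E.

Definition hausdorff_pre (s delta : R) A : \bar R :=
  ereal_inf [set (\sum_(0 <= i <oo) diam_pow s (E i))%E |
    E in [set E : (set 'rV[R]_k)^nat |
      A `<=` \bigcup_i E i /\ forall i, (eucl_diam (E i) <= delta%:E)%E]].

Definition hausdorff (s : R) A : \bar R :=
  ereal_sup [set hausdorff_pre s delta A | delta in [set delta | 0 < delta]].

End Euclidean.

Definition cc_lipschitz_on (R : realType) (G : carnotGroup R) (k : nat)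
    (U : set G) (F : G -> 'rV[R]_k) : Prop :=
  exists2 L : R, 0 <= L &
    forall a b, U a -> U b ->
      ((eucl_dist (F a) (F b))%:E <= L%:E * cc_dist a b)%E.

(* Main.v *)
Require Import Defs.
From HB Require Import structures.
From mathcomp Require Import all_boot all_order all_fingroup all_algebra.
From mathcomp Require Import ring lra.
From mathcomp Require Import all_classical all_reals all_analysis.
From mathcomp Require Import measurable_realfun.

(* In R^k take the self-similar Cantor set generated by M^k corners of a cube at
   ratio r = 1/(A M), A a constant: its dimension tends to k as M grows.  The
   group contains a Cantor set of the same combinatorics and ratio: the
   products of the exp(n X_(j,i)), 0 <= n < M^j, are M^k distinct elements of a
   discrete group, hence uniformly separated, and after dilation by a multiple
   of 1/M they lie in a fixed small ball and generate a Cantor set.  Matching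
   the two codings is a Lipschitz map between the Cantor sets, which McShane's
   formula extends to the whole group.  That the cells of the group Cantor set
   are comparable to CC balls needs Chow's theorem; discretizability gives that
   the vectors exp(X_(j,i)) are at finite distance from 1, because they lie in
   the group generated by the horizontal ones. *)

Set Implicit Arguments.
Unset Strict Implicit.
Unset Printing Implicit Defensive.

Import Order.TTheory GRing.Theory Num.Theory.
Import numFieldNormedType.Exports.

Local Open Scope classical_set_scope.
Local Open Scope ring_scope.

(** * The Baker-Campbell-Hausdorff product *)

(** The constant [A] is lost at every level: M^k pieces at ratio 1/(A M) give dimension k log M /
    (log A + log M), which tends to k only if [A] is fixed before [M]. So the geometric constants
    [D], [rho], [delta] must not depend on [M]. Dilations ensure this: ratio 1/M shrinks a vector of
    weight j by M^-j, which offsets its M^j multiples, and these counts multiply to M to the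
    homogeneous dimension. Distances in the group are bounded below by discreteness and left
    invariance, and above by rescaling one neighbourhood of 1 on which the distance is less than 1.
    Both Cantor sets are parametrized by [0, 1[ through digits in base M^k, so a cover of the image
    pulls back to a cover of an interval, whose Lebesgue measure is known. As the distance is an
    infimum over C1 curves, joining two curves takes a reparametrization that comes to rest at the
    junction. *)

Section Bch.
Context {R : realType} {n : nat}.
Notation g := 'rV[R]_n.
Variable br : g -> g -> g.
Hypothesis brL : is_lie_bracket br.

Let brl a x y z : br (a *: x + y) z = a *: br x z + br y z.
Proof. by case: brL => -[h _] _ _; exact: h. Qed.
Let brr a x y z : br z (a *: x + y) = a *: br z x + br z y.
Proof. by case: brL => -[_ h] _ _; exact: h. Qed.
Let brxx x : br x x = 0. Proof. by case: brL. Qed.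

Lemma bracket0l z : br 0 z = 0.
Proof. by have := brl (-1) 0 0 z; rewrite scaler0 addr0 scaleN1r addNr. Qed.
Lemma bracket0r z : br z 0 = 0.
Proof. by have := brr (-1) 0 0 z; rewrite scaler0 addr0 scaleN1r addNr. Qed.
Lemma bracketDl x y z : br (x + y) z = br x z + br y z.
Proof. by have := brl 1 x y z; rewrite !scale1r. Qed.
Lemma bracketDr x y z : br z (x + y) = br z x + br z y.
Proof. by have := brr 1 x y z; rewrite !scale1r. Qed.
Lemma bracketZl a x z : br (a *: x) z = a *: br x z.
Proof. by have := brl a x 0 z; rewrite !addr0 bracket0l addr0. Qed.
Lemma bracketZr a x z : br z (a *: x) = a *: br z x.
Proof. by have := brr a x 0 z; rewrite !addr0 bracket0r addr0. Qed.

Lemma bracket_suml (I : Type) (s : seq I) (P : pred I) F z :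
  br (\sum_(i <- s | P i) F i) z = \sum_(i <- s | P i) br (F i) z.
Proof.
exact: (big_morph (fun x => br x z) (fun x y => bracketDl x y z) (bracket0l z)).
Qed.
Lemma bracket_sumr (I : Type) (s : seq I) (P : pred I) F z :
  br z (\sum_(i <- s | P i) F i) = \sum_(i <- s | P i) br z (F i).
Proof.
exact: (big_morph (br z) (fun x y => bracketDr x y z) (bracket0r z)).
Qed.

(** The outermost bracket lands in [W], because the inner word is in [V]: as a single letter, or by
    induction and [W <= V]. *)
Lemma nested_bracket_mem (V W : {vspace g}) (w : seq g) :
    (W <= V)%VS ->
    (forall x y, x \in V -> y \in V -> br x y \in W) ->
  (1 < size w)%N -> {subset w <= V} -> nested_bracket br w \in W.
Proof.
move=> WV VVW; elim: w => // a [//|b w] IH _ sub.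
have aV : a \in V by apply: sub; rewrite inE eqxx.
have subw : {subset b :: w <= V} by move=> x xw; apply: sub; rewrite inE xw orbT.
apply: (VVW a (nested_bracket br (b :: w)) aV); case: w => [|c w] in IH sub subw *.
  by apply: subw; rewrite /= inE.
by apply: (subvP WV); exact: IH.
Qed.

Variable d : nat.

(** The only one-letter words in Dynkin's series are [x] and [y], from m = 1 with exponents (1, 0)
    and (0, 1), named [p0] and [p1] below. With [0 < d] the truncation keeps them. *)
Lemma bch_mod (W : {vspace g}) x y : (0 < d)%N ->
  (forall w, (1 < size w)%N -> {subset w <= [:: x; y]} ->
     nested_bracket br w \in W) ->
  bch d br x y - (x + y) \in W.
Proof.
move=> d0 hW; rewrite /bch.
have szE m (p : {ffun 'I_m -> 'I_d.+1 * 'I_d.+1}) :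
    size (flatten [seq nseq (p i).1 x ++ nseq (p i).2 y | i <- enum 'I_m]) =
    (\sum_i ((p i).1 + (p i).2))%N.
  rewrite size_flatten /shape -map_comp sumnE big_map big_enum /=.
  by apply: eq_bigr => i _; rewrite size_cat !size_nseq.
have subE m (p : {ffun 'I_m -> 'I_d.+1 * 'I_d.+1}) :
    {subset flatten [seq nseq (p i).1 x ++ nseq (p i).2 y | i <- enum 'I_m]
      <= [:: x; y]}.
  move=> z /flatten_mapP[i _]; rewrite mem_cat !mem_nseq !inE.
  by case/orP => /andP[_ ->]; rewrite ?orbT.
have termW m (p : {ffun 'I_m -> 'I_d.+1 * 'I_d.+1}) (c : R) :
    (1 < \sum_i ((p i).1 + (p i).2))%N ->
    c *: nested_bracket br
        (flatten [seq nseq (p i).1 x ++ nseq (p i).2 y | i <- enum 'I_m]) \in W.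
  by move=> h; apply: memvZ; apply: hW; rewrite ?szE //; exact: subE.
rewrite big_ltn; last by [].
rewrite addrAC; apply: memvD; last first.
  rewrite big_seq_cond; apply: memv_suml => m /andP[].
  rewrite mem_index_iota => /andP[m2 _] _.
  apply: memvZ; apply: memv_suml => p /forallP hp; apply: termW.
  (* Each of the [m >= 2] pairs contributes at least one letter. *)
  apply: leq_trans m2 _; rewrite -[leqLHS](card_ord m) -sum1_card.
  by apply: leq_sum => i _; exact: hp.
rewrite /= expr0 divr1 scale1r.
pose p0 : {ffun 'I_1 -> 'I_d.+1 * 'I_d.+1} := [ffun=> (inord 1, inord 0)].
pose p1 : {ffun 'I_1 -> 'I_d.+1 * 'I_d.+1} := [ffun=> (inord 0, inord 1)].
have i1 : (inord 1 : 'I_d.+1) = 1%N :> nat by rewrite inordK.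
have i0 : (inord 0 : 'I_d.+1) = 0%N :> nat by rewrite inordK.
rewrite (bigD1 p0) /=; last by apply/forallP => i; rewrite ffunE /= i1 i0.
rewrite (bigD1 p1) /=; last first.
  apply/andP; split; first by apply/forallP => i; rewrite ffunE /= i1 i0.
  apply/eqP => /ffunP/(_ ord0); rewrite !ffunE => -[] /(congr1 val) /=.
  by rewrite i1 i0.
set S := (X in _ + (_ + X) - _).
rewrite !big_ord1 !ffunE /= i1 i0 enum_ordSl enum_ord0 /= !ffunE /= i1 i0 /=.
rewrite !fact0 (_ : 1`! = 1)%N // muln1 mulr1 invr1 !scale1r addrA.
rewrite [x + y + _]addrC addrK {}/S.
apply: memv_suml => p /andP[/andP[/forallP hp pp0] pp1].
apply: termW; rewrite big_ord1.
have := hp ord0; rewrite ltnNge => hp0; rewrite ltn_neqAle ltnNge hp0 andbT.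
apply: contraNN pp1 => /eqP p_1.
apply/eqP/ffunP => i; rewrite !ord1 !ffunE.
case pE : (p ord0) p_1 => [[r hr] [s hs]] /=.
case: r s hr hs pE => [|[|r]] [|[|s]] hr hs // pE _.
  by congr pair; apply/val_inj; rewrite /= ?i1 ?i0.
case/eqP: pp0; apply/ffunP => j; rewrite ord1 pE !ffunE.
by congr pair; apply/val_inj; rewrite /= ?i1 ?i0.
Qed.

(** Multiples of [x] commute, so [bch_mod] applies with [W] zero. This makes t |-> Exp (t x) a
    one-parameter subgroup. *)
Lemma bch_collinear x a b : (0 < d)%N ->
  bch d br (a *: x) (b *: x) = (a + b) *: x.
Proof.
move=> d0; apply/eqP; rewrite -subr_eq0 -memv0 scalerDl.
apply: bch_mod => // w w1 sub.
apply: (@nested_bracket_mem <[x]>%VS) => //; first exact: sub0v.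
  move=> _ _ /vlineP[u ->] /vlineP[v ->].
  by rewrite bracketZl bracketZr brxx !scaler0 memv0.
by move=> z /sub; rewrite !inE => /orP[] /eqP ->; rewrite memvZ ?memv_line.
Qed.

Lemma bch_modW (V W : {vspace g}) x y : (0 < d)%N -> (W <= V)%VS ->
    (forall x y, x \in V -> y \in V -> br x y \in W) ->
  x \in V -> y \in V -> bch d br x y - (x + y) \in W.
Proof.
move=> d0 WV VVW xV yV; apply: bch_mod => // w w1 sub.
apply: (nested_bracket_mem WV VVW) => // z /sub; rewrite !inE.
by case/orP => /eqP ->.
Qed.

(** Holds for [d = 0] too, so that [Exp 0 = 1] requires no positive step. *)
Lemma bch00 : bch d br 0 0 = 0.
Proof.
case: d => [|d']; first by rewrite /bch big_geq.
rewrite /bch big1 // => m _.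
rewrite big1 ?scaler0 // => p _.
set w := flatten _.
suff -> : nested_bracket br w = 0 by rewrite scaler0.
have : {subset w <= [:: 0]}.
  move=> z /flatten_mapP[i _]; rewrite mem_cat !mem_nseq inE.
  by case/orP => /andP[_ ->].
elim: w => // a w IH sub; have := sub a; rewrite inE eqxx => /(_ isT).
rewrite inE => /eqP ->; case: w IH sub => [|b w] // _ _.
exact: bracket0l.
Qed.

Lemma bch_morph (f : {linear g -> g}) x y :
  (forall x y, f (br x y) = br (f x) (f y)) ->
  f (bch d br x y) = bch d br (f x) (f y).
Proof.
move=> fM.
have fN w : f (nested_bracket br w) = nested_bracket br (map f w).
  elim: w => [|a [//|b w] IH]; first by rewrite linear0.
  rewrite [LHS]fM [X in br _ X]IH. by [].
rewrite /bch linear_sum; apply: eq_bigr => m _.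
rewrite linearZ linear_sum; congr (_ *: _); apply: eq_bigr => p _.
rewrite linearZ; congr (_ *: _); rewrite fN map_flatten -map_comp.
congr nested_bracket; congr flatten; apply: eq_map => i /=.
by rewrite map_cat !map_nseq.
Qed.

End Bch.

(** * Continuity *)

Section RowContinuity.
Context {R : realType} {n : nat}.

Lemma cvg_suml {V : normedModType R} {T : Type} (F : set_system T) {FF : Filter F}
    (I : Type) (r : seq I) (P : pred I) (f : I -> T -> V) (l : I -> V) :
  (forall i, P i -> f i @ F --> l i) ->
  (\sum_(i <- r | P i) f i t) @[t --> F] --> \sum_(i <- r | P i) l i.
Proof.
by move=> fl; apply: cvg_big => //; exact: add_continuous.
Qed.

Lemma cvg_coord {T : Type} (F : set_system T) {FF : Filter F}
    (f : T -> 'rV[R]_n) (a : 'rV[R]_n) i :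
  f @ F --> a -> f t ord0 i @[t --> F] --> a ord0 i.
Proof.
move=> fa; apply: (@cvg_comp _ _ _ f (fun v : 'rV[R]_n => v ord0 i) F (nbhs a)) => //.
exact: coord_continuous.
Qed.

Lemma linear_row_continuous {V : normedModType R} (f : {linear 'rV[R]_n -> V}) :
  continuous f.
Proof.
move=> a.
have fE x : f x = \sum_j x ord0 j *: f (delta_mx 0 j).
  by rewrite {1}(row_sum_delta x) linear_sum; apply: eq_bigr => j _; rewrite linearZ.
have -> : (f : 'rV[R]_n -> V) = fun x => \sum_j x ord0 j *: f (delta_mx 0 j).
  by apply/funext => x; exact: fE.
apply: (@cvg_suml _ _ (nbhs a)) => j _.
by apply: cvgZ; [exact: coord_continuous | exact: cvg_cst].
Qed.

Lemma bilinear_cvg {V : normedModType R} (b : 'rV[R]_n -> 'rV[R]_n -> V)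
    {T : Type} (F : set_system T) {FF : Filter F} (f g : T -> 'rV[R]_n) (x y : 'rV[R]_n) :
  bilinear_map b -> f @ F --> x -> g @ F --> y ->
  b (f t) (g t) @[t --> F] --> b x y.
Proof.
move=> [bl br] fx gy.
have lin z : linear (b ^~ z) by move=> a u v; exact: bl.
have linr z : linear (b z) by move=> a u v; exact: br.
pose bL z := GRing.isLinear.Build _ _ _ _ _ (lin z).
pose bR z := GRing.isLinear.Build _ _ _ _ _ (linr z).
pose BL z : {linear 'rV[R]_n -> V} := HB.pack (b ^~ z) (bL z).
pose BR z : {linear 'rV[R]_n -> V} := HB.pack (b z) (bR z).
have bE u v : b u v = \sum_i u ord0 i *: (\sum_j v ord0 j *: b (delta_mx 0 i) (delta_mx 0 j)).
  rewrite -[b u v]/(BL v u) {1}(row_sum_delta u) linear_sum; apply: eq_bigr => i _.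
  rewrite linearZ; congr (_ *: _).
  rewrite -[LHS]/(BR _ v) {1}(row_sum_delta v) linear_sum; apply: eq_bigr => j _.
  by rewrite linearZ.
under eq_fun do rewrite bE; rewrite bE.
apply: cvg_suml => i _; apply: cvgZ; first exact: cvg_coord.
apply: cvg_suml => j _; apply: cvgZ; [exact: cvg_coord | exact: cvg_cst].
Qed.

Lemma bch_cvg (br : 'rV[R]_n -> 'rV[R]_n -> 'rV[R]_n) d
    {T : Type} (F : set_system T) {FF : Filter F} (f g : T -> 'rV[R]_n) (x y : 'rV[R]_n) :
  bilinear_map br -> f @ F --> x -> g @ F --> y ->
  bch d br (f t) (g t) @[t --> F] --> bch d br x y.
Proof.
move=> brB fx gy; apply: cvg_suml => m _; apply: cvgZ; first exact: cvg_cst.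
apply: cvg_suml => p _; apply: cvgZ; first exact: cvg_cst.
(* Coding the word by booleans lets one induction treat the word in [f t], [g t] and the word in the
   limits together. *)
pose w (u v : 'rV[R]_n) (b : bool) := if b then u else v.
pose s := flatten [seq nseq (p i).1 true ++ nseq (p i).2 false | i <- enum 'I_m].
have sE u v : flatten [seq nseq (p i).1 u ++ nseq (p i).2 v | i <- enum 'I_m] =
    map (w u v) s.
  rewrite /s map_flatten -map_comp; congr flatten; apply: eq_map => i /=.
  by rewrite map_cat !map_nseq.
under eq_fun do rewrite sE; rewrite sE.
elim: s {sE} => [|b s IH] /=; first exact: cvg_cst.
have bT : w (f t) (g t) b @[t --> F] --> w x y b by case: b.
case: s IH => [|c s] IH; first exact: bT.
exact: bilinear_cvg.
Qed.

End RowContinuity.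

(** * A smooth step *)

Section Derivatives.
Context {R : realType}.
Implicit Types (V W : normedModType R).

Lemma is_deriveP V (f : R -> V) (t : R) (v : V) :
  is_derive t 1 f v <-> h^-1 *: (f (h + t) - f t) @[h --> 0^'] --> v.
Proof.
have fE : (fun h : R => h^-1 *: (f (h + t) - f t)) =
    (fun h => h^-1 *: ((f \o shift t) (h *: (1 : R^o)) - f t)).
  by apply/funext => h /=; rewrite [h *: _]mulr1.
rewrite fE; split => [[dt <-]//|fv].
apply: DeriveDef; first by apply/cvg_ex; exists v.
exact: cvg_lim fv.
Qed.

Lemma is_derive_linear n V (A : {linear 'rV[R]_n -> V})
    (f : R -> 'rV[R]_n) (t : R) (v : 'rV[R]_n) :
  is_derive t 1 f v -> is_derive t 1 (A \o f) (A v).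
Proof.
move=> /is_deriveP fv; apply/is_deriveP.
under eq_fun do rewrite /= -linearB -linearZ.
apply: cvg_comp fv _; exact: linear_row_continuous.
Qed.

Lemma is_derive_comp V (f : R -> V) (s : R -> R) (t : R) (v : V) (c : R) :
  is_derive (s t) 1 f v -> is_derive t 1 s c -> is_derive t 1 (f \o s) (c *: v).
Proof.
move=> [fs <-] [st <-].
move: (fs) (st) => /derivable1_diffP dfs /derivable1_diffP dst.
have dcomp := differentiable_comp dst dfs.
apply: DeriveDef; first by apply/derivable1_diffP.
rewrite -derive1E derive1E' // diff_comp //= -!derive1E !derive1E' //.
by rewrite -linearZ /= [_ *: _]mulr1.
Qed.

Lemma is_derive_quadratic (f : R -> R) (x c K : R) :
  (forall h, `|f (h + x) - f x - c * h| <= K * h ^+ 2) -> is_derive x 1 f c.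
Proof.
move=> fK; apply/is_deriveP/cvgrPdist_le => e e0.
have K0 : 0 <= K by have := le_trans (normr_ge0 _) (fK 1); rewrite expr1n mulr1.
near=> h.
have h0 : h != 0 by near: h; exact: nbhs_dnbhs_neq.
have -> : c - h^-1 *: (f (h + x) - f x) = - (h^-1 * (f (h + x) - f x - c * h)).
  by rewrite /GRing.scale /=; field.
rewrite normrN normrM normfV ler_pdivrMl ?normr_gt0 //.
apply: le_trans (fK h) _; rewrite -real_normK ?num_real // expr2 mulrCA.
rewrite ler_wpM2l //.
have : `|h| <= e / (K + 1).
  by near: h; apply: dnbhs0_le; rewrite divr_gt0 //; lra.
rewrite ler_pdivlMr; last by lra.
by have := normr_ge0 h; nra.
Unshelve. all: by end_near. Qed.

Definition ramp (x : R) : R := Num.max x 0.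

Lemma rampP x : (0 <= x /\ ramp x = x) \/ (x <= 0 /\ ramp x = 0).
Proof.
by rewrite /ramp; case: (leP x 0) => h; [right|left]; rewrite ?(ltW h).
Qed.

Lemma ramp_continuous : continuous ramp.
Proof. by move=> x; apply: continuous_max; [exact: cvg_id|exact: cvg_cst]. Qed.

(* A C^1 function equal to 0 on ]-oo, 0] and to 1 on [1, +oo[; its derivative is
   the tent function [dsmoothstep]. *)
Definition smoothstep (x : R) : R :=
  2 * (ramp x ^+ 2 - 2 * ramp (x - 2^-1) ^+ 2 + ramp (x - 1) ^+ 2).
Definition dsmoothstep (x : R) : R :=
  4 * (ramp x - 2 * ramp (x - 2^-1) + ramp (x - 1)).

Ltac ramps := rewrite /smoothstep /dsmoothstep;
  repeat match goal with |- context [ramp ?x] => case: (rampP x) => -[? ->] end.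

Lemma smoothstep_le0 x : x <= 0 -> smoothstep x = 0.
Proof. by move=> x0; ramps; nra. Qed.
Lemma smoothstep_ge1 x : 1 <= x -> smoothstep x = 1.
Proof. by move=> x1; ramps; nra. Qed.
Lemma dsmoothstep_le0 x : x <= 0 -> dsmoothstep x = 0.
Proof. by move=> x0; ramps; lra. Qed.
Lemma dsmoothstep_ge1 x : 1 <= x -> dsmoothstep x = 0.
Proof. by move=> x1; ramps; lra. Qed.
Lemma dsmoothstep_ge0 x : 0 <= dsmoothstep x.
Proof. by ramps; lra. Qed.

Lemma smoothstep_incr x y : 0 <= x -> x < y -> y <= 1 ->
  smoothstep x < smoothstep y.
Proof. by move=> x0 xy y1; ramps; nra. Qed.

Lemma smoothstep_01 x : 0 <= smoothstep x <= 1.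
Proof.
have [x0|x0] := leP x 0; first by rewrite smoothstep_le0 // lexx ler01.
have [x1|x1] := leP 1 x; first by rewrite smoothstep_ge1 // lexx ler01.
have := @smoothstep_incr 0 x; have := @smoothstep_incr x 1.
rewrite (@smoothstep_le0 0) // (@smoothstep_ge1 1) // => h1 h0.
by rewrite !ltW // ?h1 ?h0 // ltW.
Qed.

Lemma dsmoothstep_continuous : continuous dsmoothstep.
Proof.
move=> x; have rc a : ramp (z - a) @[z --> x] --> ramp (x - a).
  apply: cvg_comp; last exact: ramp_continuous.
  by apply: cvgB; [exact: cvg_id|exact: cvg_cst].
apply: cvgM; first exact: cvg_cst.
apply: cvgD; last exact: rc.
apply: cvgB; first exact: ramp_continuous.
by apply: cvgM; [exact: cvg_cst | exact: rc].
Qed.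

Lemma is_derive_smoothstep (x : R) : is_derive x 1 smoothstep (dsmoothstep x).
Proof.
have rd (a : R) : is_derive x 1 (fun z : R => ramp (z - a) ^+ 2) (2 * ramp (x - a)).
  apply: (@is_derive_quadratic _ _ _ 1) => h.
  by case: (rampP (h + x - a)) => -[? ->]; case: (rampP (x - a)) => -[? ->];
    rewrite ler_norml; apply/andP; split; nra.
have -> : smoothstep = (2 *: (((fun z => ramp (z - 0) ^+ 2)
   - (2 *: (fun z => ramp (z - 2^-1) ^+ 2)) : R -> R) + (fun z => ramp (z - 1) ^+ 2))).
  by apply/funext => z; rewrite /smoothstep -{1}[z]subr0.
apply: is_derive_eq.
by rewrite /dsmoothstep subr0 /GRing.scale /=; ring.
Qed.

Lemma is_derive_smoothstep_affine (c t : R) :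
  is_derive t 1 (fun s : R => smoothstep (2 * (s - c)))
    (2 * dsmoothstep (2 * (t - c))).
Proof.
rewrite mulrC; apply: (@is_derive1_comp _ smoothstep (fun t => 2 * (t - c))).
  exact: is_derive_smoothstep.
apply: (@is_derive_quadratic _ _ _ 0) => h.
by rewrite mul0r normr_le0; apply/eqP; ring.
Qed.

Lemma smoothstep_affine_continuous (c : R) :
  continuous (fun t : R => smoothstep (2 * (t - c))).
Proof.
move=> t; apply: differentiable_continuous; apply/derivable1_diffP.
by case: (is_derive_smoothstep_affine c t).
Qed.

Lemma dsmoothstep_affine_continuous (c : R) :
  continuous (fun t : R => 2 * dsmoothstep (2 * (t - c))).
Proof.
move=> t; apply: cvgM; first exact: cvg_cst.
apply: (cvg_comp (fun t => 2 * (t - c)) dsmoothstep); last exact: dsmoothstep_continuous.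
apply: cvgM; first exact: cvg_cst.
by apply: cvgB; [exact: cvg_id | exact: cvg_cst].
Qed.

End Derivatives.

Section IntegralStep.
Context {R : realType}.

(** Substitution along an increasing map of the half-length interval onto [0, 1]. With [f] the speed
    of a curve, the reparametrized curve has the same length. *)
Lemma integral_step (f : R -> R) (c : R) : continuous f ->
  (\int[lebesgue_measure]_(t in `[c, (c + 2^-1)%R])
     (2 * dsmoothstep (2 * (t - c)) * f (smoothstep (2 * (t - c))))%:E =
   \int[lebesgue_measure]_(t in `[0%R, 1%R]) (f t)%:E)%E.
Proof.
move=> fc; pose F (t : R) := smoothstep (2 * (t - c)).
have cF : F c = 0 by rewrite /F subrr mulr0 smoothstep_le0.
have cF1 : F (c + 2^-1) = 1 by rewrite /F addrC addKr mulfV ?smoothstep_ge1.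
have dF (t : R) : is_derive t 1 F (2 * dsmoothstep (2 * (t - c))).
  exact: is_derive_smoothstep_affine.
have F'E : derive1 F = fun t => 2 * dsmoothstep (2 * (t - c)).
  by apply/funext => t; rewrite derive1E; exact: derive_val.
have F'c : continuous (derive1 F).
  by rewrite F'E; exact: dsmoothstep_affine_continuous.
have Fc : continuous F by exact: smoothstep_affine_continuous.
have := @integration_by_substitution_increasing R F f c (c + 2^-1).
rewrite cF cF1 => -> //.
- by apply: eq_integral => t _; rewrite F'E /= mulrC.
- lra.
- move=> x y; rewrite !in_itv /= => x1 y1 xy; apply: smoothstep_incr; lra.
- by apply/cvg_ex; eexists; apply: cvg_at_right_filter; exact: F'c.
- by apply/cvg_ex; eexists; apply: cvg_at_left_filter; exact: F'c.
- split => //.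
  + by have := cvg_at_right_filter (Fc c); rewrite cF.
  + by have := cvg_at_left_filter (Fc (c + 2^-1)); rewrite cF1.
- exact: continuous_subspaceT.
Qed.

End IntegralStep.

(** * The Carnot-Caratheodory distance *)

Section CCDistance.
Context {R : realType} (G : carnotGroup R).
Notation g := 'rV[R]_(lie_dim G).
Local Notation mu := (@lebesgue_measure R).
Implicit Types (a b c : G) (gam : R -> G) (v : R -> g).

Lemma Exp0 : Exp (0 : g) = 1%g.
Proof.
have := ExpM (0 : g) 0; rewrite bch00; last exact: bracket_lie.
by move=> h; apply: (@mulgI _ (Exp (0 : g))); rewrite mulg1.
Qed.

Lemma Log1 : Log (1 : G)%g = 0.
Proof. by rewrite -Exp0 ExpK. Qed.

Definition norm1 (x : g) : R := Num.sqrt (inner1 x x).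

Lemma norm1Z (k : R) x : norm1 (k *: x) = `|k| * norm1 x.
Proof.
have [bl br] := inner1_bilinear G.
have i0l z : @inner1 R G 0 z = 0.
  by have := bl (-1) 0 0 z; rewrite scaler0 addr0 scaleN1r addNr.
have i0r z : @inner1 R G z 0 = 0.
  by have := br (-1) 0 0 z; rewrite scaler0 addr0 scaleN1r addNr.
have -> : norm1 (k *: x) = Num.sqrt (k ^+ 2 * inner1 x x).
  rewrite /norm1; congr Num.sqrt.
  have := bl k x 0 (k *: x); rewrite !addr0 i0l addr0 => ->.
  have := br k x 0 x; rewrite !addr0 i0r addr0 => ->.
  by rewrite /GRing.scale /= mulrA expr2.
by rewrite sqrtrM ?sqr_ge0 // sqrtr_sqr.
Qed.

Lemma norm1_continuous v : continuous v -> continuous (norm1 \o v).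
Proof.
move=> vc t.
apply: (@cvg_comp _ _ _ (fun t => inner1 (v t) (v t) : R) Num.sqrt
  _ _ _ _ (@sqrt_continuous R _)).
by apply: bilinear_cvg; [exact: inner1_bilinear | exact: vc | exact: vc].
Qed.

Definition ltrans_log gam t s : g := Log ((gam t)^-1 * gam s)%g.

(** The velocity [v] is explicit data, so a new curve comes with its derivative instead of a
    [derive1] to be computed. *)
Definition horizontal_from_to gam v a b :=
  [/\ forall t : R, is_derive t 1 (ltrans_log gam t) (v t), continuous v,
      forall t : R, 0 <= t <= 1 -> v t \in layer G 1, gam 0 = a & gam 1 = b].

Definition vel_length v : \bar R := (\int[mu]_(t in `[0%R, 1%R]) (norm1 (v t))%:E)%E.

Lemma cc_dist_le gam v a b :
  horizontal_from_to gam v a b -> (cc_dist a b <= vel_length v)%E.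
Proof.
move=> [dv vc v1 ga gb].
have vE : velocity gam = v.
  by apply/funext => t; rewrite /velocity derive1E; case: (dv t).
apply: ereal_inf_lbound; exists gam; last by rewrite /curve_length vE.
split=> //; split; last by rewrite vE.
by split; [move=> t; case: (dv t) | rewrite vE].
Qed.

Lemma cc_dist_ge a b x :
  (forall gam v, horizontal_from_to gam v a b -> (x <= vel_length v)%E) ->
  (x <= cc_dist a b)%E.
Proof.
move=> h; apply: le_ereal_inf_tmp => _ [gam [[[dv vc] v1] ga gb] <-].
apply: (h gam (velocity gam)); split => // t.
by rewrite /velocity derive1E; exact: (derivableP (dv t)).
Qed.

Lemma length_ge0 v : (0 <= vel_length v)%E.
Proof. by apply: integral_ge0 => t _; rewrite lee_fin sqrtr_ge0. Qed.

Lemma cc_dist_ge0 a b : (0 <= cc_dist a b)%E.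
Proof. by apply: cc_dist_ge => *; exact: length_ge0. Qed.

Lemma cc_dist_ltrans_le c a b : (cc_dist (c * a)%g (c * b)%g <= cc_dist a b)%E.
Proof.
apply: cc_dist_ge => gam v [dv vc v1 ga gb].
apply: (@cc_dist_le (fun t => c * gam t)%g); split => //; rewrite ?ga ?gb //.
move=> t; suff -> : ltrans_log (fun t => c * gam t)%g t = ltrans_log gam t by [].
by apply/funext => s; rewrite /ltrans_log invgM -mulgA mulKg.
Qed.

Lemma cc_dist_ltrans c a b : cc_dist (c * a)%g (c * b)%g = cc_dist a b.
Proof.
apply/eqP; rewrite eq_le cc_dist_ltrans_le /=.
by rewrite -{1}(mulKg c a) -{1}(mulKg c b) cc_dist_ltrans_le.
Qed.

Lemma cc_dist_refl a : cc_dist a a = 0%E.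
Proof.
apply/eqP; rewrite eq_le cc_dist_ge0 andbT.
have := @cc_dist_le (fun=> a) (fun=> 0) a a.
have -> : vel_length (fun=> 0) = 0%E.
  by rewrite /vel_length -(scale0r (0 : g)) norm1Z normr0 mul0r integral0.
apply; split => //.
- by move=> t; exact: is_derive_cst.
- by move=> t; exact: cvg_cst.
- by move=> t _; rewrite mem0v.
Qed.

Lemma cc_dist_exp (x : g) : (0 < step G)%N -> x \in layer G 1 ->
  (cc_dist 1%g (Exp x) < +oo)%E.
Proof.
move=> st0 x1; apply: (@le_lt_trans _ _ (vel_length (fun=> x))); last first.
  rewrite /vel_length integral_cst //= lebesgue_measure_itv /= lte_fin ltr01.
  by rewrite -EFinD -EFinM ltry.
apply: (@cc_dist_le (fun t => Exp (t *: x))); split => //.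
- move=> t.
  have -> : ltrans_log (fun t => Exp (t *: x)) t = fun s => (s - t) *: x.
    apply/funext => s; rewrite /ltrans_log.
    have -> : ((Exp (t *: x))^-1 = Exp ((- t) *: x))%g.
      apply: (@mulgI _ (Exp (t *: x))); rewrite mulgV ExpM bch_collinear //.
        by rewrite subrr scale0r Exp0.
      exact: bracket_lie.
    by rewrite ExpM ExpK bch_collinear ?(addrC s) //; exact: bracket_lie.
  apply/is_deriveP; apply: cvg_near_cst; near=> h.
  have h0 : h != 0 by near: h; exact: nbhs_dnbhs_neq.
  by rewrite subrr scale0r subr0 addrK scalerA mulVf // scale1r.
- by move=> t; exact: cvg_cst.
- by rewrite scale0r Exp0.
- by rewrite scale1r.
Unshelve. all: by end_near. Qed.

Lemma cc_dist_sym_le a b : (cc_dist a b <= cc_dist b a)%E.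
Proof.
apply: cc_dist_ge => gam v [dv vc v1 ga gb].
have -> : vel_length v = vel_length (fun t => - v (1 - t)).
  rewrite /vel_length (@integration_by_substitution_onem R (norm1 \o v) 1) ?ler01 ?lexx //; last first.
    by apply: continuous_subspaceT; exact: norm1_continuous.
  rewrite unstable.onem1; apply: eq_integral => t _ /=.
  by rewrite -scaleN1r norm1Z normrN1 mul1r.
apply: (@cc_dist_le (fun t => gam (1 - t))); split.
- move=> t.
  have := @is_derive_comp _ _ (ltrans_log gam (1 - t)) (fun s => 1 - s) t (v (1 - t)) (-1).
  rewrite scaleN1r; apply.
  apply: (@is_derive_quadratic _ _ _ _ 0) => h.
  by rewrite mul0r normr_le0; apply/eqP; ring.
- move=> t; apply: cvgN; apply: cvg_comp; last exact: vc.
  by apply: cvgB; [exact: cvg_cst | exact: cvg_id].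
- by move=> t t01; rewrite memvN; apply: v1; lra.
- by rewrite subr0.
- by rewrite subrr.
Qed.

Lemma cc_dist_sym a b : cc_dist a b = cc_dist b a.
Proof. by apply/eqP; rewrite eq_le !cc_dist_sym_le. Qed.


End CCDistance.
Arguments norm1 {R G} x.
Arguments vel_length {R G} v.

(** * Joining two horizontal curves *)

Section Concatenation.
Context {R : realType} (G : carnotGroup R).
Notation g := 'rV[R]_(lie_dim G).
Local Notation mu := (@lebesgue_measure R).
Variables (a b c : G) (gam1 gam2 : R -> G) (v1 v2 : R -> g).
Hypotheses (h1 : horizontal_from_to gam1 v1 a b)
           (h2 : horizontal_from_to gam2 v2 b c).

Let S1 (t : R) := smoothstep (2 * (t - 0)).
Let S2 (t : R) := smoothstep (2 * (t - 2^-1)).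
Let D1 (t : R) := 2 * dsmoothstep (2 * (t - 0)).
Let D2 (t : R) := 2 * dsmoothstep (2 * (t - 2^-1)).

(** One formula serves both halves: up to 1/2 the last factor is [b], from 1/2 on the first factor
    is [b], and either cancels [b^-1]. Both speeds [D1] and [D2] vanish at 1/2, so the velocity is
    continuous there. *)
Let gam t := (gam1 (S1 t) * b^-1 * gam2 (S2 t))%g.
Let v t : g := D1 t *: v1 (S1 t) + D2 t *: v2 (S2 t).

Let S1_ge t : 2^-1 <= t -> S1 t = 1 /\ D1 t = 0.
Proof.
by move=> ht; rewrite /S1 /D1 smoothstep_ge1 ?dsmoothstep_ge1 ?mulr0 //; lra.
Qed.
Let S2_le t : t <= 2^-1 -> S2 t = 0 /\ D2 t = 0.
Proof.
by move=> ht; rewrite /S2 /D2 smoothstep_le0 ?dsmoothstep_le0 ?mulr0 //; lra.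
Qed.

Let deriv_step (e : R) (f : R -> g) (x : g) (t : R) :
  is_derive (smoothstep (2 * (t - e))) 1 f x ->
  is_derive t 1 (fun s : R => f (smoothstep (2 * (s - e))))
   ((2 * dsmoothstep (2 * (t - e))) *: x).
Proof.
move=> df; apply: (@is_derive_comp _ _ f (fun s => smoothstep (2 * (s - e)))) => //.
exact: is_derive_smoothstep_affine.
Qed.

Let gam_le t : t <= 2^-1 -> gam t = gam1 (S1 t).
Proof.
case: h2 => _ _ _ g20 _.
by move=> /S2_le[h _]; rewrite /gam h g20 -mulgA mulVg mulg1.
Qed.
Let gam_ge t : 2^-1 <= t -> gam t = gam2 (S2 t).
Proof.
case: h1 => _ _ _ _ g11.
by move=> /S1_ge[h _]; rewrite /gam h g11 mulgV mul1g.
Qed.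

(* Near [t] at least one of the two steps is constant, except at [t = 1/2] where
   one of the two logarithms below vanishes on each side; so in all cases the
   logarithm along the concatenation is the sum of the two. *)
Lemma deriv_concat (t : R) : is_derive t 1 (ltrans_log gam t) (v t).
Proof.
case: (h1) (h2) => [d1 c1 _ g10 g11] [d2 c2 _ g20 g21].
have := is_deriveD (@deriv_step 0 _ _ t (d1 _)) (@deriv_step 2^-1 _ _ t (d2 _)).
apply: near_eq_is_derive.
have sum_le s : t <= 2^-1 -> s <= 2^-1 -> ltrans_log gam1 (S1 t) (S1 s) +
    ltrans_log gam2 (S2 t) (S2 s) = ltrans_log gam t s.
  move=> ht hs; rewrite /ltrans_log !gam_le //.
  by have [-> _] := S2_le ht; have [-> _] := S2_le hs; rewrite mulVg Log1 addr0.
have sum_ge s : 2^-1 <= t -> 2^-1 <= s -> ltrans_log gam1 (S1 t) (S1 s) +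
    ltrans_log gam2 (S2 t) (S2 s) = ltrans_log gam t s.
  move=> ht hs; rewrite /ltrans_log !gam_ge //.
  by have [-> _] := S1_ge ht; have [-> _] := S1_ge hs; rewrite mulVg Log1 add0r.
have [tlt|tgt|tE] := ltgtP t 2^-1.
- near=> s; apply: sum_le; first exact: ltW.
  by near: s; apply: filterS (lt_nbhsl tlt) => s; exact: ltW.
- near=> s; apply: sum_ge; first exact: ltW.
  by near: s; apply: filterS (lt_nbhsr tgt) => s; exact: ltW.
- near=> s; have [hs|hs] := leP s 2^-1.
    by apply: sum_le => //; rewrite tE.
  by apply: sum_ge; rewrite ?tE // ltW.
Unshelve. all: by end_near. Qed.

Lemma concat_horizontal : horizontal_from_to gam v a c.
Proof.
split; first exact: deriv_concat.
- case: (h1) (h2) => [_ c1 _ _ _] [_ c2 _ _ _] t.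
  apply: (@continuousD _ _ _ (fun t => D1 t *: v1 (S1 t)) (fun t => D2 t *: v2 (S2 t)));
    apply: continuousZ; try exact: dsmoothstep_affine_continuous.
    by apply: continuous_comp; [exact: smoothstep_affine_continuous | exact: c1].
  by apply: continuous_comp; [exact: smoothstep_affine_continuous | exact: c2].
- case: (h1) (h2) => [_ _ m1 _ _] [_ _ m2 _ _] t _.
  by apply: memvD; apply: memvZ; [apply: m1 | apply: m2]; exact: smoothstep_01.
- rewrite gam_le ?invr_ge0 //.
  by case: h1 => _ _ _ <- _; rewrite /S1 smoothstep_le0 // subr0 mulr0.
- rewrite gam_ge; last by lra.
  by case: h2 => _ _ _ _ <-; rewrite /S2 smoothstep_ge1 //; lra.
Qed.

(** On each half only one summand of [v] survives, and [integral_step] gives back the length of the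
    original curve. *)
Lemma length_concat : vel_length v = (vel_length v1 + vel_length v2)%E.
Proof.
have vc : continuous (norm1 \o v).
  by apply: norm1_continuous; case: concat_horizontal.
have mv (A : set R) : measurable_fun A (EFin \o (norm1 \o v)).
  apply/measurable_EFinP; apply: measurable_funS (measurableT) (@subsetT _ _) _.
  exact: continuous_measurable_fun.
rewrite /vel_length.
rewrite [in LHS](@itv_bndbnd_setU _ _ _ (BLeft (2^-1 : R))); last 2 first.
- by rewrite bnd_simp; lra.
- by rewrite bnd_simp; lra.
rewrite ge0_integral_setU //=; last 3 first.
- exact: mv.
- by move=> t _; rewrite lee_fin sqrtr_ge0.
- apply/disj_setPS => y [/=]; rewrite 2!in_itv/= => /andP[_ yx] /andP[].
  by rewrite leNgt yx.
rewrite integral_itv_bndo_bndc //; congr (_ + _)%E.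
- have v1c : continuous v1 by case: h1.
  have := @integral_step R _ 0 (norm1_continuous v1c); rewrite add0r => H.
  apply: etrans _ H.
  apply: eq_integral => t /[1!inE] /=; rewrite in_itv /= => /andP[_ /S2_le[S20 D20]].
  rewrite /v D20 scale0r addr0 norm1Z ger0_norm //.
  by rewrite mulr_ge0 // dsmoothstep_ge0.
- have v2c : continuous v2 by case: h2.
  have := @integral_step R _ 2^-1 (norm1_continuous v2c).
  rewrite (_ : 2^-1 + 2^-1 = 1); last by lra.
  move=> H; apply: etrans _ H.
  apply: eq_integral => t /[1!inE] /=; rewrite in_itv /= => /andP[/S1_ge[S10 D10] _].
  rewrite /v D10 scale0r add0r norm1Z ger0_norm //.
  by rewrite mulr_ge0 // dsmoothstep_ge0.
Qed.

End Concatenation.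

Section Triangle.
Context {R : realType} (G : carnotGroup R).
Implicit Types a b c : G.

(** The infimum is taken over one curve at a time, with the other term moved across the inequality;
    that term must be finite, hence the separate infinite cases. *)
Lemma cc_dist_triangle a b c : (cc_dist a c <= cc_dist a b + cc_dist b c)%E.
Proof.
have leD2 gam1 v1 : horizontal_from_to gam1 v1 a b ->
    (cc_dist a c <= vel_length v1 + cc_dist b c)%E.
  move=> h1; have [l1|] := boolP (vel_length v1 \is a fin_num); last first.
    rewrite ge0_fin_numE ?length_ge0 // ltey negbK => /eqP ->.
    by rewrite addye ?leey // gt_eqF // (lt_le_trans _ (cc_dist_ge0 _ _)).
  rewrite addeC -leeBlDr //; apply: cc_dist_ge => gam2 v2 h2.
  rewrite leeBlDr // addeC -(length_concat h1 h2).
  exact: (cc_dist_le (concat_horizontal h1 h2)).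
have [bc|] := boolP (cc_dist b c \is a fin_num); last first.
  rewrite ge0_fin_numE ?cc_dist_ge0 // ltey negbK => /eqP ->.
  by rewrite addey ?leey // gt_eqF // (lt_le_trans _ (cc_dist_ge0 _ _)).
rewrite -leeBlDr //; apply: cc_dist_ge => gam1 v1 h1.
by rewrite leeBlDr //; exact: leD2 h1.
Qed.

(** A Lie algebra endomorphism respects the BCH product, hence induces a group endomorphism. It
    carries a curve of velocity [v] to one of velocity [A \o v], which is [k] times [v] on [0, 1],
    where [v] is horizontal. *)
Lemma cc_dist_morph (A : {linear 'rV[R]_(lie_dim G) -> 'rV[R]_(lie_dim G)}) (k : R) a b :
    0 < k ->
    (forall x y, A (bracket x y) = bracket (A x) (A y)) ->
    (forall x, x \in layer G 1 -> A x = k *: x) ->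
  (cc_dist (Exp (A (Log a))) (Exp (A (Log b))) <= k%:E * cc_dist a b)%E.
Proof.
move=> k0 AM A1; rewrite -lee_pdivrMl //; apply: cc_dist_ge => gam v h.
rewrite lee_pdivrMl //.
pose D a := Exp (A (Log a)).
have DM x y : D (x * y)%g = (D x * D y)%g.
  rewrite /D ExpM; congr Exp; rewrite -{1}(LogK x) -{1}(LogK y) ExpM ExpK.
  by apply: bch_morph.
have DV x : D (x^-1)%g = ((D x)^-1)%g.
  apply: (@mulgI _ (D x)); rewrite -DM !mulgV /D Log1 linear0 ; exact: Exp0.
case: h => dv vc v1 ga gb.
have -> : (k%:E * vel_length v = vel_length (A \o v))%E.
  rewrite /vel_length -ge0_integralZl //=.
  - apply: eq_integral => t /[1!inE] /=; rewrite in_itv /= => t01.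
    by rewrite A1 ?v1 // norm1Z gtr0_norm.
  - apply/measurable_EFinP; apply: measurable_funS (measurableT) (@subsetT _ _) _.
    by apply: continuous_measurable_fun; exact: norm1_continuous.
  - by move=> t _; rewrite lee_fin sqrtr_ge0.
  - by rewrite lee_fin ltW.
apply: (@cc_dist_le _ _ (D \o gam)); split.
- move=> t; have -> : ltrans_log (D \o gam) t = A \o ltrans_log gam t.
    apply/funext => s; rewrite /ltrans_log /= -DV -DM /D ExpK //.
  exact: is_derive_linear.
- move=> t; apply: cvg_comp; [exact: vc | exact: linear_row_continuous].
- by move=> t t01; rewrite /= A1 ?memvZ // v1.
- by rewrite /= ga.
- by rewrite /= gb.
Qed.

End Triangle.

(** * Layers and dilations *)

Section Layers.
Context {R : realType} (G : carnotGroup R).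
Notation g := 'rV[R]_(lie_dim G).

Lemma layers_ext (V : lmodType R) (f1 f2 : {linear g -> V}) :
  (forall j x, x \in layer G j -> f1 x = f2 x) -> f1 =1 f2.
Proof.
move=> f12 x; have : x \in (\sum_(i < step G) layer G i.+1)%VS.
  by rewrite layer_full memvf.
move=> /memv_sumP[xs xsi ->]; rewrite !linear_sum; apply: eq_bigr => i _.
by apply: f12; exact: xsi.
Qed.

Lemma layers_ind (P : g -> Prop) :
  P 0 -> (forall x y, P x -> P y -> P (x + y)) ->
  (forall j x, x \in layer G j -> P x) -> forall x, P x.
Proof.
move=> P0 PD Pl x; have : x \in (\sum_(i < step G) layer G i.+1)%VS.
  by rewrite layer_full memvf.
move=> /memv_sumP[xs xsi ->]; elim/big_ind: _ => // i _.
exact: (Pl i.+1 _ (xsi i isT)).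
Qed.

Definition dil (k : R) : 'End(g) :=
  (\sum_(i < step G) k ^+ i.+1 *:
     sumv_pi_for (erefl (\sum_(i < step G) layer G i.+1)%VS) i)%VF.

Lemma dil_layer k j x : x \in layer G j -> dil k x = k ^+ j *: x.
Proof.
case: j => [|j] xj.
  by move: xj; rewrite layer0 memv0 => /eqP ->; rewrite linear0 scaler0.
have [jst|jst] := ltnP j (step G); last first.
  by move: xj; rewrite layer_gt_step // memv0 => /eqP ->; rewrite linear0 scaler0.
pose j' := Ordinal jst; rewrite /dil sum_lfunE.
set dV := erefl _.
have piE i : sumv_pi_for dV i x = if i == j' then x else 0.
  have /directv_sum_unique := layer_direct G.
  move/(_ (fun i => sumv_pi_for dV i x) (fun i => if i == j' then x else 0)).
  have -> : \sum_(i < step G) (if i == j' then x else 0) = x.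
    by rewrite -big_mkcond big_pred1_eq.
  rewrite sumv_pi_sum ?layer_full ?memvf // eqxx => h.
  have {h} := h _ _; move=> h; apply/eqP.
  have /forall_inP : [forall (i | true), sumv_pi_for dV i x == if i == j' then x else 0].
    rewrite -h //; first by move=> k' _; exact: memv_sum_pi.
    by move=> k' _; case: eqP => [->|_]; rewrite ?mem0v.
  exact.
move: (sumv_pi_for dV) piE => pi piE.
rewrite (bigD1 j') //= big1 ?addr0; last first.
  by move=> i /negPf ij; rewrite scale_lfunE piE ij scaler0.
by rewrite scale_lfunE piE eqxx.
Qed.

Lemma dil_bracket k (x y : g) :
  dil k (bracket x y) = bracket (dil k x) (dil k y).
Proof.
have brL := bracket_lie G.
move: x y; apply: layers_ind => [y|x x' IHx IHx' y|i x xi y].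
- by rewrite (bracket0l brL) linear0 (bracket0l brL).
- by rewrite (bracketDl brL) !linearD /= (bracketDl brL) IHx IHx'.
move: y; apply: layers_ind => [|y y' IHy IHy'|j y yj].
- by rewrite (bracket0r brL) linear0 (bracket0r brL).
- by rewrite (bracketDr brL) !linearD /= (bracketDr brL) IHy IHy'.
rewrite (dil_layer _ (layer_graded xi yj)) (dil_layer _ xi) (dil_layer _ yj).
by rewrite (bracketZl brL) (bracketZr brL) scalerA exprD.
Qed.

Lemma dilM k l (x : g) : dil k (dil l x) = dil (k * l) x.
Proof.
apply: (@layers_ext _ (dil k \o dil l) (dil (k * l))) => j {}x xj /=.
by rewrite !(dil_layer _ xj) linearZ /= (dil_layer _ xj) scalerA exprMn mulrC.
Qed.

Lemma dil1 (x : g) : dil 1 x = x.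
Proof.
apply: (@layers_ext _ (dil 1) idfun) => j {}x xj /=.
by rewrite (dil_layer _ xj) expr1n scale1r.
Qed.

Lemma cc_dist_dil (k : R) (x y : g) : 0 < k ->
  cc_dist (Exp (dil k x)) (Exp (dil k y)) = (k%:E * cc_dist (Exp x) (Exp y))%E.
Proof.
have le k' (x' y' : g) : 0 < k' -> (cc_dist (Exp (dil k' x')) (Exp (dil k' y')) <=
    k'%:E * cc_dist (Exp x') (Exp y'))%E.
  move=> k0; have := @cc_dist_morph _ _ (dil k') k' (Exp x') (Exp y') k0.
  rewrite !ExpK; apply; first exact: dil_bracket.
  by move=> z z1; rewrite /= (dil_layer _ z1) expr1.
move=> k0; apply/eqP; rewrite eq_le le //=.
have := le k^-1 (dil k x) (dil k y); rewrite invr_gt0 => /(_ k0).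
rewrite !dilM mulVf ?gt_eqF // !dil1 => h.
by rewrite -lee_pdivlMl.
Qed.

Definition layers_from j : {vspace g} :=
  (\sum_(j <= i < (step G).+1) layer G i)%VS.

Lemma layers_from1 : layers_from 1 = fullv.
Proof.
by rewrite -layer_full /layers_from big_add1 /= big_mkord.
Qed.

Lemma layer_sub j i : (j <= i)%N -> (layer G i <= layers_from j)%VS.
Proof.
move=> ji; have [ist|ist] := leqP i (step G); last first.
  by rewrite layer_gt_step // sub0v.
rewrite /layers_from (big_cat_nat ji) /=; last exact: leqW.
apply: subv_trans (addvSr _ _).
by rewrite big_ltn // addvSl.
Qed.

Lemma layers_fromS j i : (j <= i)%N -> (layers_from i <= layers_from j)%VS.
Proof.
move=> ji; rewrite {1}/layers_from big_seq_cond.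
elim/big_ind: _ => [|U V|k /andP[]]; first exact: sub0v.
  by rewrite subv_add => -> ->.
rewrite mem_index_iota => /andP[ik _] _.
by apply: layer_sub; exact: leq_trans ik.
Qed.

Lemma layers_fromP j x : x \in layers_from j ->
  exists2 xs, forall k, (j <= k)%N -> xs k \in layer G k &
    x = \sum_(j <= k < (step G).+1) xs k.
Proof.
rewrite /layers_from big_geq_mkord => /memv_sumP[xs xsi ->].
exists (fun k => if insub k is Some k' then xs k' else 0).
  move=> k jk; case: insubP => [k' _ kk'|_]; last exact: mem0v.
  by rewrite -kk'; apply: xsi; rewrite /= kk' jk.
by rewrite [RHS]big_geq_mkord; apply: eq_bigr => k _; rewrite valK.
Qed.

Lemma layers_from_bracket i j x y :
  x \in layers_from i -> y \in layers_from j ->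
  bracket x y \in layers_from (i + j).
Proof.
have brL := bracket_lie G.
move=> xi yj.
move: xi yj => /layers_fromP[xs xsi ->] /layers_fromP[ys ysj ->].
rewrite (bracket_suml brL) big_seq_cond; apply: memv_suml => k /andP[].
rewrite mem_index_iota => /andP[ik _] _.
rewrite (bracket_sumr brL) big_seq_cond; apply: memv_suml => l /andP[].
rewrite mem_index_iota => /andP[jl _] _.
have := layer_graded (xsi k ik) (ysj l jl).
by apply: (subvP (layer_sub _)); exact: leq_add.
Qed.

End Layers.

(** * Weighted bases and lattice points *)

Section WeightedBasis.
Context {R : realType} (G : carnotGroup R).
Notation g := 'rV[R]_(lie_dim G).
Hypothesis step_gt0 : (0 < step G)%N.
Let brL := bracket_lie G.

Lemma ExpN (x : g) : Exp (- x) = (Exp x)^-1%g.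
Proof.
apply: (@mulgI _ (Exp x)); rewrite mulgV ExpM -{1}[x]scale1r -scaleN1r.
by rewrite (bch_collinear brL) // subrr scale0r Exp0.
Qed.

Lemma Exp_natmul (x : g) n : Exp (n%:R *: x) = (Exp x ^+ n)%g.
Proof.
elim: n => [|n IH]; first by rewrite scale0r Exp0.
rewrite expgS -IH ExpM -{2}[x]scale1r (bch_collinear brL) //.
by rewrite -natr1 addrC.
Qed.

Lemma cc_dist1V (a : G) : cc_dist 1%g a^-1%g = cc_dist 1%g a.
Proof. by rewrite -(cc_dist_ltrans a) mulg1 mulgV cc_dist_sym. Qed.

(* A strong Malcev basis of weight vectors [(w, x)] with exponentials in [H]. *)
Fixpoint weighted_basis (H : set G) (L : seq (nat * g)) : Prop :=
  if L is (w, x) :: L' then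
    [/\ (0 < w)%N, x \in layer G w, x \notin <<map snd L'>>%VS, H (Exp x) &
        [/\ forall y z, y \in <<x :: map snd L'>>%VS -> z \in <<x :: map snd L'>>%VS ->
              bracket y z \in <<map snd L'>>%VS
         & weighted_basis H L']]
  else True.

Lemma bch_suffix x (s : seq g) y z :
  (forall y z, y \in <<x :: s>>%VS -> z \in <<x :: s>>%VS ->
     bracket y z \in << s >>%VS) ->
  y \in <<x :: s>>%VS -> z \in <<x :: s>>%VS ->
  bch (step G) (@bracket _ G) y z - (y + z) \in << s >>%VS.
Proof.
move=> h yV zV; apply: (bch_modW step_gt0 _ h yV zV).
by rewrite span_cons addvSr.
Qed.

Section Lattice.
Variable H : set G.
Hypothesis HG : is_subgroup H.

(** Logarithms of ordered products of powers (Malcev coordinates of the second kind). The range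
    [M ^ w] matches the factor M^-w of the dilation of ratio 1/M on weight [w]. *)
Fixpoint lattice (M : nat) (L : seq (nat * g)) : seq g :=
  if L is (w, x) :: L' then
    [seq bch (step G) (@bracket _ G) (n%:R *: x) h |
       n <- iota 0 (M ^ w), h <- lattice M L']
  else [:: 0].

Lemma size_lattice M L : size (lattice M L) = (M ^ \sum_(p <- L) p.1)%N.
Proof.
elim: L => [|[w x] L IH] /=; first by rewrite big_nil expn0.
by rewrite size_allpairs IH size_iota big_cons expnD.
Qed.

Lemma lattice_span M L h : weighted_basis H L -> h \in lattice M L ->
  h \in <<map snd L>>%VS.
Proof.
elim: L h => [|[w x] L IH] h /=; first by rewrite inE => _ /eqP ->; exact: mem0v.
move=> [_ _ _ _ [brW LW]] /allpairsP[[n h'] /= [_ h'L ->]].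
have h'V : h' \in <<x :: map snd L>>%VS.
  by rewrite (subvP _ _ (IH _ LW h'L)) // span_cons addvSr.
have xV : n%:R *: x \in <<x :: map snd L>>%VS.
  by rewrite memvZ // memv_span // inE eqxx.
rewrite -(subrK (n%:R *: x + h') (bch _ _ _ _)) memvD //; last exact: memvD.
by apply: (subvP _ _ (bch_suffix brW xV h'V)); rewrite span_cons addvSr.
Qed.

Lemma lattice_subgroup M L h : weighted_basis H L -> h \in lattice M L ->
  H (Exp h).
Proof.
case: HG => H1 HM _.
elim: L h => [|[w x] L IH] h /=; first by rewrite inE => _ /eqP ->; rewrite Exp0.
move=> [_ _ _ Hx [_ LW]] /allpairsP[[n h'] /= [_ h'L ->]].
rewrite -ExpM; apply: (HM); last exact: IH.
rewrite Exp_natmul; elim: n => [|n IHn] //.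
by rewrite expgS; exact: HM.
Qed.

(** Modulo the span of the tail the product is [n%:R *: x], and [x] is outside that span, so the
    point determines [n]. Cancelling the left factor then leaves the tail. *)
Lemma lattice_uniq M L : weighted_basis H L -> uniq (lattice M L).
Proof.
elim: L => [|[w x] L IH] //= [_ _ xL _ [brW LW]].
apply: allpairs_uniq; [exact: iota_uniq | exact: IH |].
move=> _ _ /allpairsP[[n h] /= [_ hL ->]] /allpairsP[[n' h'] /= [_ h'L ->]] /= E.
have hV := lattice_span LW hL; have h'V := lattice_span LW h'L.
have LV : (<<map snd L>> <= <<x :: map snd L>>)%VS by rewrite span_cons addvSr.
have xV m : m%:R *: x \in <<x :: map snd L>>%VS.
  by rewrite memvZ // memv_span // inE eqxx.
have nn' : n = n'.
  apply/eqP; apply: contraNT xL => nn'.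
  have d0 : n%:R - n'%:R != 0 :> R by rewrite subr_eq0 eqr_nat.
  rewrite -[x](scalerK d0) memvZ // scalerBl.
  have := bch_suffix brW (xV n) (subvP LV _ hV).
  have := bch_suffix brW (xV n') (subvP LV _ h'V).
  rewrite -E; set b := bch _ _ _ _ => b' b''.
  have -> : n%:R *: x - n'%:R *: x =
      (b - (n'%:R *: x + h')) - (b - (n%:R *: x + h)) + h' - h.
    rewrite !opprB !opprD !addrA; move: (n%:R *: x) (n'%:R *: x) => u u'.
    by apply/rowP => i; rewrite !mxE; ring.
  by rewrite memvB // memvD // memvB.
subst n'; congr pair; have := congr1 (@Exp R G) E.
by rewrite -!ExpM => /mulgI /(can_inj (@ExpK _ G)).
Qed.

(** The bound [e] is uniform in [M]: since n < M^w, the dilated factor has coefficient n (k / M)^w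
    <= k^w <= k. Dilations are automorphisms, so the rest follows by continuity of the product. *)
Lemma dil_lattice_small L (P : set g) : weighted_basis H L -> nbhs (0 : g) P ->
  exists2 e : R, 0 < e & forall (k : R) M h, 0 < k -> k <= e -> (0 < M)%N ->
    h \in lattice M L -> P (dil G (k / M%:R) h).
Proof.
elim: L P => [|[w x] L IH] P /=.
  move=> _ P0; exists 1 => // k M h _ _ _; rewrite inE => /eqP ->.
  by rewrite linear0; exact: nbhs_singleton.
move=> [w0 xw _ _ [_ LW]] P0.
have bchc : bch (step G) (@bracket _ G) z.1 z.2 @[z --> (0 : g, 0 : g)] --> (0 : g).
  rewrite -[X in _ --> X](bch00 brL (step G)).
  by apply: bch_cvg; [case: brL | exact: cvg_fst | exact: cvg_snd].
have [[A B] /= [A0 B0] AB] := bchc _ P0.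
have [e e0 he] := IH _ LW B0.
have xc : t *: x @[t --> (0 : R)] --> (0 : g).
  by rewrite -[X in _ --> X](scale0r x); apply: cvgZr_tmp; exact: cvg_id.
have [d /= d0 hd] := (nbhs_ballP _ _).1 (xc _ A0).
(* The 1 gives k^w <= k; halving [d] makes the ball condition strict. *)
exists (Num.min (Num.min e 1) (d / 2)); first by rewrite !lt_min e0 ltr01 /= divr_gt0.
move=> k M h k0 + M0 /allpairsP[[n h'] /= [nM h'L ->]].
rewrite !le_min => /andP[/andP[ke k1] kd].
have -> : dil G (k / M%:R) (bch (step G) (@bracket _ G) (n%:R *: x) h') =
    bch (step G) (@bracket _ G) (dil G (k / M%:R) (n%:R *: x)) (dil G (k / M%:R) h').
  by apply: (bch_morph) => u v; exact: dil_bracket.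
have -> : dil G (k / M%:R) (n%:R *: x) = (n%:R * (k / M%:R) ^+ w) *: x.
  by rewrite linearZ /= (dil_layer _ xw) scalerA.
apply: (AB (_, _)); split; last exact: he.
apply: hd.
have M0' : 0 < M%:R :> R by rewrite ltr0n.
rewrite /ball /= sub0r normrN ger0_norm; last first.
  by rewrite mulr_ge0 // exprn_ge0 // divr_ge0 // ltW.
have nle : n%:R <= M%:R ^+ w :> R.
  by move: nM; rewrite mem_iota add0n -natrX ler_nat => /andP[_ /ltnW].
apply: (@le_lt_trans _ _ k); last by apply: le_lt_trans kd _; lra.
rewrite expr_div_n mulrA ler_pdivrMr ?exprn_gt0 //.
have kw : k ^+ w <= k.
  by rewrite -[leRHS]expr1; apply: ler_wiXn2l => //; exact: ltW.
rewrite mulrC; apply: ler_pM => //; by rewrite exprn_ge0 // ltW.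
Qed.

End Lattice.

(** Brackets of elements of layers at least j lie in layers at least 2j >= j + 1, hence in the span
    of [L], whichever vectors of [s] remain in front. *)
Lemma weighted_basis_cat (H : set G) j (s : seq g) L :
    (0 < j <= step G)%N -> weighted_basis H L ->
    {subset s <= layer G j} -> (forall x, x \in s -> H (Exp x)) ->
    <<map snd L>>%VS = layers_from G j.+1 ->
    free (s ++ map snd L) ->
  weighted_basis H ([seq (j, x) | x <- s] ++ L).
Proof.
move=> /andP[j0 jst] LW + + Lj; elim: s => [|x s IH] //= sj sH.
rewrite free_cons => /andP[xL fr].
have E : map snd ([seq (j, x0) | x0 <- s] ++ L) = s ++ map snd L.
  by rewrite map_cat -map_comp map_id_in.
rewrite E; split=> //.
- by apply: sj; rewrite inE eqxx.
- by apply: sH; rewrite inE eqxx.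
have sub : (<<x :: s ++ map snd L>> <= layers_from G j)%VS.
  apply/span_subvP => y; rewrite inE mem_cat => /or3P[/eqP ->|ys|yL].
  - by apply: (subvP (layer_sub G (leqnn j))); apply: sj; rewrite inE eqxx.
  - by apply: (subvP (layer_sub G (leqnn j))); apply: sj; rewrite inE ys orbT.
  - by apply: (subvP (layers_fromS G (leqnSn j))); rewrite -Lj memv_span.
split; last first.
  apply: IH => // y ys; [apply: sj | apply: sH]; by rewrite inE ys orbT.
move=> y z /(subvP sub) yj /(subvP sub) zj.
have := layers_from_bracket yj zj.
have jj : (j.+1 <= j + j)%N by rewrite -addn1 leq_add2l.
move/(subvP (layers_fromS G jj)); rewrite -Lj.
by apply: subvP; rewrite span_cat addvSr.
Qed.

Lemma weighted_basis_exists : discretizable G ->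
  exists (H : set G) (L : seq (nat * g)),
    [/\ is_subgroup H, cc_discrete H, forall a, H a -> (cc_dist 1%g a < +oo)%E &
        [/\ weighted_basis H L, basis_of fullv (map snd L) &
            (\sum_(p <- L) p.1)%N = hom_dim G]].
Proof.
move=> [X /= [Xspan discr HE]].
set G' := subgroup_generated _ in discr HE.
have gen_sub (A : set G) : is_subgroup (subgroup_generated A).
  split.
  - by move=> B [[h _ _] _].
  - by move=> a b ha hb B hB; case: (hB) => -[_ h _] _; apply: h; [apply: ha|apply: hb].
  - by move=> a ha B hB; case: (hB) => -[_ _ h] _; apply: h; apply: ha.
have Xsub j : (0 < j <= step G)%N -> {subset X j <= layer G j}.
  by move=> jst x xX; rewrite -(Xspan _ jst) memv_span.
(* The point is a generator of [H_ j], and [H_ j] is the trace of [G'] on [G_ j]. *)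
have HX j i : (1 <= j <= step G)%N -> G' (Exp (tnth (X j) i)).
  move=> jst; suff : (G' `&` subgroup_generated
      [set a | exists j' x, [/\ (j <= j' <= step G)%N, x \in layer G j' & a = Exp x]])
      (Exp (tnth (X j) i)) by case.
  rewrite HE //= => B [_]; apply; exists j, i; split => //.
  by rewrite leqnn /=; case/andP: jst.
have Hfin a : G' a -> (cc_dist 1%g a < +oo)%E.
  move: a; apply: (@smallest_sub _ (@is_subgroup R G) _ [set a | (cc_dist 1%g a < +oo)%E]).
    split; first by rewrite /= cc_dist_refl.
    - move=> b c /= hb hc; apply: le_lt_trans (cc_dist_triangle _ b _) _.
      by rewrite lte_add_pinfty // -{1}[b]mulg1 cc_dist_ltrans.
    - by move=> b /=; rewrite cc_dist1V.
  move=> _ [i ->] /=; apply: cc_dist_exp => //.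
  by apply: Xsub; rewrite ?step_gt0 // mem_tnth.
pose Lfrom j := flatten [seq [seq (i, x) | x <- X i] | i <- index_iota j (step G).+1].
have Lspan j : (0 < j)%N -> (j <= (step G).+1)%N -> <<map snd (Lfrom j)>>%VS = layers_from G j.
  move=> j0 jst; rewrite /Lfrom /layers_from map_flatten -map_comp.
  have : all (fun i => 0 < i <= step G)%N (index_iota j (step G).+1).
    apply/allP => i; rewrite mem_index_iota => /andP[ji]; rewrite ltnS => ->.
    by rewrite andbT; exact: leq_trans ji.
  elim: (index_iota _ _) => [|i s IH] /=; first by rewrite big_nil span_nil.
  move=> /andP[ist sst]; rewrite big_cons span_cat IH //; congr (_ + _)%VS.
  by rewrite -map_comp map_id_in // Xspan.
have Lsize : size (Lfrom 1) = \dim (fullv : {vspace g}).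
  have /directvP := layer_direct G; rewrite /= layer_full => ->.
  rewrite /Lfrom size_flatten /shape -map_comp sumnE big_map big_add1 /= big_mkord.
  by apply: eq_bigr => i _ /=; rewrite size_map size_tuple.
have Lbasis : basis_of fullv (map snd (Lfrom 1)).
  by rewrite basisEdim Lspan // layers_from1 subvv size_map Lsize leqnn.
exists G', (Lfrom 1); split => //; first exact: gen_sub.
split => //; last first.
  rewrite /Lfrom big_flatten /= big_map /hom_dim; apply: eq_bigr => j _.
  by rewrite big_map /= big_const_seq count_predT size_tuple iter_addn_0 mulnC.
have Lrec j : (j <= step G)%N -> Lfrom j = [seq (j, x) | x <- X j] ++ Lfrom j.+1.
  by move=> jst; rewrite /Lfrom /index_iota subSn.
have Lfree j : (0 < j)%N -> (j <= (step G).+1)%N -> free (map snd (Lfrom j)).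
  elim: j => // -[_ _ _|j IH _ jst]; first exact: basis_free Lbasis.
  have := IH isT (ltnW jst); rewrite Lrec // map_cat; exact: catr_free.
(* Downward induction on the starting layer: [k] counts the layers already listed, none at [k = 0]
   and all at [k = step G]. The second disjunct absorbs larger [k]. *)
have LW k : weighted_basis G' (Lfrom ((step G).+1 - k)%N) \/ (k > step G)%N.
  elim: k => [|k [IH|kst]]; first by left; rewrite subn0 /Lfrom /index_iota subnn.
    have [kst|kst] := ltnP k (step G); [left|by right].
    set j := ((step G).+1 - k.+1)%N.
    have jE : ((step G).+1 - k)%N = j.+1 by rewrite /j subSS subSn // ltnW.
    have jst : (0 < j <= step G)%N by rewrite /j subSS subn_gt0 kst leq_subr.
    rewrite jE in IH; case/andP: (jst) => j0 jst'.
    rewrite Lrec //; apply: weighted_basis_cat => //; first exact: Xsub.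
    - by move=> x /tnthP[i ->]; exact: HX.
    - by rewrite Lspan.
    - have := Lfree _ j0 (leqW jst'); rewrite Lrec // map_cat -map_comp map_id_in //.
  by right; exact: leqW.
have [|] := LW (step G); first by rewrite subSn // subnn.
by rewrite ltnn.
Qed.

End WeightedBasis.

(** * Chow's theorem *)

Section BallBox.
Context {R : realType} (G : carnotGroup R).
Notation g := 'rV[R]_(lie_dim G).
Hypothesis step_gt0 : (0 < step G)%N.
Let brL := bracket_lie G.

(** For t > 0, Exp (t x) is the dilate of Exp x by t^(1/w), so its distance from 1 is t^(1/w) times
    a finite number. Negative t reduces to this by inversion. *)
Lemma cc_dist_line_near w (x : g) e : (0 < w)%N -> x \in layer G w ->
  (cc_dist 1%g (Exp x) < +oo)%E -> 0 < e ->
  \forall t \near (0 : R), (cc_dist 1%g (Exp (t *: x)) < e%:E)%E.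
Proof.
move=> w0 xw xfin e0.
have [d dE] : exists d : R, cc_dist 1%g (Exp x) = d%:E.
  by exists (fine (cc_dist 1%g (Exp x))); rewrite fineK // ge0_fin_numE ?cc_dist_ge0.
have d0 : 0 <= d by rewrite -lee_fin -dE cc_dist_ge0.
pose l := e / (d + 1).
have l0 : 0 < l by rewrite divr_gt0 //; lra.
have ld : l * d < e.
  by rewrite /l mulrAC ltr_pdivrMr; nra.
near=> t.
have [t0|t0] := eqVneq t 0.
  by rewrite t0 scale0r Exp0 cc_dist_refl lte_fin.
have tl : `|t| <= l ^+ w.
  near: t; apply/nbhs_ballP; exists (l ^+ w); first exact: exprn_gt0.
  by move=> t; rewrite /ball /= sub0r normrN => /ltW.
have nt : 0 < `|t| by rewrite normr_gt0.
pose k := `|t| `^ (w%:R^-1).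
have k0 : 0 < k by exact: powR_gt0.
have kw : k ^+ w = `|t|.
  rewrite -powR_mulrn ?ltW // -powRrM mulVf ?powRr1 ?ltW //.
  by rewrite pnatr_eq0 -lt0n.
have kl : k <= l.
  rewrite leNgt; apply/negP => lk; move: tl; rewrite leNgt -kw => /negP; apply.
  by rewrite ltr_pXn2r // nnegrE ltW.
have E : cc_dist 1%g (Exp (t *: x)) = cc_dist 1%g (Exp (`|t| *: x)).
  case: (ler0P t) => [_|//].
  by rewrite scaleNr ExpN // cc_dist1V.
rewrite E -kw -(dil_layer _ xw) -Exp0 -(linear0 (dil G k)) cc_dist_dil // Exp0 dE.
rewrite -EFinM lte_fin; apply: le_lt_trans ld.
by rewrite ler_wpM2r.
Unshelve. all: by end_near. Qed.

(** The coordinate along [x] is a linear form on the whole space, so it is continuous at 0. *)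
Lemma span_cons_coord (x : g) (X : seq g) :
  exists f : {linear g -> R^o}, forall y, y \in <<x :: X>>%VS ->
    y - f y *: x \in <<X>>%VS.
Proof.
pose p := addv_pi1 <[x]> <<X>>; pose c := coord [tuple x] ord0.
exists (c \o p)%FUN => y; rewrite span_cons => /addv_pi1_pi2 yE.
have : p y \in <<[tuple x]>>%VS by rewrite span_seq1 memv_pi1.
move=> /coord_span; rewrite big_ord1 /= => pE.
by rewrite -{1}yE -/p {1}pE addrC addKr memv_pi2.
Qed.

(* Chow's theorem, quantitatively: peel off the first vector of the basis,
   [y = f y *: x + _], so that [Exp y = Exp (f y *: x) * Exp z] where [z]
   lies in the span of the remaining vectors and is small with [y]. *)
Lemma cc_dist_near (H : set G) L e :
    (forall a, H a -> (cc_dist 1%g a < +oo)%E) -> weighted_basis H L -> 0 < e ->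
  \forall y \near (0 : g), y \in <<map snd L>>%VS ->
    (cc_dist 1%g (Exp y) < e%:E)%E.
Proof.
move=> Hfin; elim: L e => [|[w x] L IH] e /=.
  move=> _ e0; near=> y; rewrite span_nil memv0 => /eqP ->.
  by rewrite Exp0 cc_dist_refl lte_fin.
move=> [w0 xw _ Hx [brW LW]] e0.
have [f fP] := span_cons_coord x (map snd L).
have e20 : 0 < e / 2 by lra.
have fc : f y @[y --> (0 : g)] --> (0 : R^o).
  by rewrite -[X in _ --> X](linear0 f); exact: linear_row_continuous.
pose z (y : g) := bch (step G) (@bracket _ G) (- f y *: x) y.
have zc : z y @[y --> (0 : g)] --> (0 : g).
  rewrite -[X in _ --> X](bch00 brL (step G)); 
  apply: (@bch_cvg _ _ _ _ _ (nbhs (0 : g)) _ (fun y => - f y *: x) id).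
  - by case: brL.
  - rewrite -[X in _ --> X](scale0r x); apply: cvgZr_tmp.
    by rewrite -[X in _ --> X]oppr0; exact: cvgN.
  - exact: cvg_id.
have Lnear := zc _ (IH _ LW e20).
have xnear := fc _ (cc_dist_line_near w0 xw (Hfin _ Hx) e20).
near=> y => yV.
have xV : - f y *: x \in <<x :: map snd L>>%VS.
  by rewrite memvZ // memv_span // inE eqxx.
have zL : z y \in <<map snd L>>%VS.
  rewrite -(subrK (- f y *: x + y) (z y)) memvD //.
    exact: (bch_suffix step_gt0 brW xV yV).
  by rewrite scaleNr addrC fP.
have yE : Exp y = (Exp (f y *: x) * Exp (z y))%g.
  by rewrite /z -ExpM mulgA scaleNr ExpN // mulgV mul1g.
rewrite yE; apply: le_lt_trans (cc_dist_triangle _ (Exp (f y *: x)) _) _.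
rewrite -{2}[Exp (f y *: x)]mulg1 cc_dist_ltrans.
rewrite (_ : e = e / 2 + e / 2); last by lra.
rewrite EFinD; apply: lteD.
- by near: y; exact: xnear.
- by move: zL; near: y; exact: Lnear.
Unshelve. all: by end_near. Qed.

Lemma row_norm_le m (c : 'rV[R]_m) e : 0 <= e ->
  (`|c| <= e) = [forall i, `|c ord0 i| <= e].
Proof.
move=> e0; rewrite /Num.norm /= mx_normrE.
apply/idP/forallP => [|h].
  move=> /bigmax_leP[_ h] i; exact: (h (ord0, i)).
by apply/bigmax_leP; split => // -[i j] _; rewrite ord1; exact: h.
Qed.

(** Along weight vectors the dilation is diagonal with entries k^w <= k, as w >= 1 and k <= 1, so it
    contracts the sup norm. Unit balls of this norm are the model cells of the Cantor set. *)
Lemma weighted_coordinates (H : set G) L :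
    weighted_basis H L -> basis_of fullv (map snd L) ->
  exists m (E : {linear 'rV[R]_m -> g}) (C : {linear g -> 'rV[R]_m}),
    [/\ cancel E C, cancel C E &
        forall (k : R) y, 0 <= k <= 1 -> `|C (dil G k y)| <= k * `|C y| ].
Proof.
move=> LW Lb; pose X := in_tuple (map snd L).
(* The default 1 keeps the weight positive beyond the end of the list. *)
pose ws i := nth 1%N (map fst L) i.
have wsP i : (0 < ws i)%N /\ X`_i \in layer G (ws i).
  rewrite /ws /=; elim: L LW {Lb X ws} i => [_ i|[w y] L IH [w0 yw _ _ [_ LW]] [|i]] //=.
    by rewrite !nth_nil mem0v.
  exact: IH.
pose Ef (c : 'rV[R]_(size (map snd L))) : g := \sum_i c ord0 i *: X`_i.
pose Cf (y : g) : 'rV[R]_(size (map snd L)) := \row_i coord X i y.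
have El : linear Ef.
  move=> a u v; rewrite /Ef scaler_sumr -big_split; apply: eq_bigr => i _.
  by rewrite !mxE scalerDl scalerA.
have Cl : linear Cf by move=> a u v; apply/rowP => i; rewrite !mxE linearP.
pose EL := GRing.isLinear.Build _ _ _ _ _ El.
pose CL := GRing.isLinear.Build _ _ _ _ _ Cl.
pose E : {linear 'rV[R]_(size (map snd L)) -> g} := HB.pack Ef EL.
pose C : {linear g -> 'rV[R]_(size (map snd L))} := HB.pack Cf CL.
have EC : cancel E C.
  move=> c; apply/rowP => i; rewrite mxE /= /Ef.
  rewrite (@coord_sum_free _ _ _ X (fun i => c ord0 i) i (basis_free Lb)).
  by congr (c _ _); exact: val_inj.
have CE : cancel C E.
  have LbX : basis_of fullv X by exact: Lb.
  move=> y; rewrite [RHS](coord_basis LbX (memvf y)) /= /Ef.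
  by apply: eq_bigr => i _; rewrite mxE.
exists _, E, C; split => // k y /andP[k0 k1].
rewrite -{1}(CE y); move: (C y) => c.
have -> : dil G k (E c) = E (\row_i (k ^+ ws i * c ord0 i)).
  rewrite /= /Ef linear_sum; apply: eq_bigr => i _.
  by rewrite mxE linearZ /= (dil_layer _ (wsP i).2) scalerA mulrC.
rewrite EC row_norm_le ?mulr_ge0 //; apply/forallP => i; rewrite mxE normrM.
apply: ler_pM => //.
  rewrite ger0_norm ?exprn_ge0 // -[leRHS]expr1.
  by apply: ler_wiXn2l => //; exact: (wsP i).1.
by have := lexx `|c|; rewrite row_norm_le // => /forallP.
Qed.

End BallBox.

(** * Dilated lattice points, with constants independent of [M] *)

Section SeparatedPoints.
Context {R : realType} (G : carnotGroup R).
Notation g := 'rV[R]_(lie_dim G).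
Hypothesis step_gt0 : (0 < step G)%N.
Let brL := bracket_lie G.

(** Gathers the geometry of [G] that the Cantor set rests on. [D], [rho] and [delta] are quantified
    before [M], which keeps the constant in the ratio fixed as [M] grows. *)
Lemma separated_points : discretizable G ->
  exists m (E : {linear 'rV[R]_m -> g}) (C : {linear g -> 'rV[R]_m})
      (D rho delta : R),
    [/\ cancel E C /\ cancel C E,
        forall (k : R) y, 0 <= k <= 1 -> `|C (dil G k y)| <= k * `|C y|,
        forall a b : G, (cc_dist a b < +oo)%E &
        [/\ 0 < D, 0 < rho, 0 < delta,
        forall y, `|C y| <= 1 -> (cc_dist 1%g (Exp y) <= D%:E)%E &
        forall M, (0 < M)%N -> exists s : seq g,
          [/\ size s = (M ^ hom_dim G)%N,
              forall i j, (i < size s)%N -> (j < size s)%N -> i != j ->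
                ((delta / M%:R)%:E <= cc_dist (Exp s`_i) (Exp s`_j))%E &
              forall a z, a \in s -> `|C z| <= rho ->
                `|C (bch (step G) (@bracket _ G) a z)| <= 1]]].
Proof.
move=> /(weighted_basis_exists step_gt0)[H [L [Hgrp Hdis Hfin [LW Lb Lsum]]]].
have [m [E [C [EC CE Cdil]]]] := weighted_coordinates LW Lb.
have Ec : E c @[c --> (0 : 'rV[R]_m)] --> (0 : g).
  by rewrite -[X in _ --> X](linear0 E); exact: linear_row_continuous.
have Cc : C y @[y --> (0 : g)] --> (0 : 'rV[R]_m).
  by rewrite -[X in _ --> X](linear0 C); exact: linear_row_continuous.
have nbhsC (P : set g) : nbhs (0 : g) P -> exists e : R, [/\ 0 < e, e <= 1 &
    forall y, `|C y| <= e -> P y].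
  move=> /Ec /nbhs_ballP[d /= d0 dP]; exists (Num.min (d / 2) 1).
  rewrite lt_min divr_gt0 //= ltr01 ge_min lexx orbT; split=> // y.
  rewrite le_min => /andP[yd _]; rewrite -(CE y); apply: dP.
  by rewrite -ball_normE /ball_ /= sub0r normrN; apply: le_lt_trans yd _; lra.
(* Chow's theorem puts the box of size [eta] in the unit CC ball; dilating by 1/eta bounds the unit
   box, so [D] is [eta^-1]. *)
have [eta [eta0 eta1 etaP]] := nbhsC _ (cc_dist_near step_gt0 Hfin LW ltr01).
have boxD y : `|C y| <= 1 -> (cc_dist 1%g (Exp y) <= (eta^-1)%:E)%E.
  move=> y1; have := etaP (dil G eta y) _ _.
  rewrite (span_basis Lb) memvf => /(_ _ isT).
  rewrite -{1}Exp0 -(linear0 (dil G eta)) cc_dist_dil // Exp0 => h.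
  rewrite -[leRHS]mule1 lee_pdivlMl //; apply/ltW/h.
  apply: le_trans (Cdil _ _ _) _; first by rewrite ltW.
  by rewrite -[leRHS]mulr1 ler_wpM2l // ltW.
have fin1 (y : g) : (cc_dist 1%g (Exp y) < +oo)%E.
  (* Dilation by this [k] brings [y] into the unit box. *)
  pose k := (1 + `|C y|)^-1.
  have Cy := normr_ge0 (C y).
  have k0 : 0 < k by rewrite invr_gt0; lra.
  have := boxD (dil G k y) _.
  rewrite -{1}Exp0 -(linear0 (dil G k)) cc_dist_dil // Exp0 => h.
  have {h} : (k%:E * cc_dist 1%g (Exp y) <= (eta^-1)%:E)%E.
    apply: h; apply: le_trans (Cdil _ _ _) _.
      by rewrite ltW //= /k invf_le1; lra.
    by rewrite /k ler_pdivrMl; lra.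
  rewrite -lee_pdivlMl // => h; apply: le_lt_trans h _.
  by rewrite -EFinM ltry.
have bchc : bch (step G) (@bracket _ G) z.1 z.2 @[z --> (0 : g, 0 : g)] --> (0 : g).
  rewrite -[X in _ --> X](bch00 brL (step G)).
  by apply: bch_cvg; [case: brL | exact: cvg_fst | exact: cvg_snd].
have C1 : nbhs (0 : g) [set y | `|C y| <= 1].
  have := Cc [set c | `|c| <= 1]; apply; apply/nbhs_ballP; exists 1 => //= c.
  by rewrite -ball_normE /ball_ /= sub0r normrN => /ltW.
(* [A] will hold the dilated lattice points and [B] the box of size [rho]; their product stays in
   the unit box, which nests the cells. *)
have [[A B] /= [A0 B0] AB] := bchc _ C1.
have [rho [rho0 _ rhoP]] := nbhsC _ B0.
have [e e0 eP] := dil_lattice_small LW A0.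
case: (Hgrp) => H1 HM HV.
have [r r0 rP] := Hdis _ H1.
(* Distinct points of [H] are at least [r] apart, by discreteness at 1 and left invariance, and the
   dilation has ratio [e / M]. *)
exists m, E, C, eta^-1, rho, (e * r); split => //.
- move=> a b; rewrite -(cc_dist_ltrans a^-1%g) mulVg -(LogK (a^-1 * b)%g).
  exact: fin1.
split => //; [by rewrite invr_gt0 | exact: mulr_gt0 |].
move=> M M0; have k0 : 0 < e / M%:R by rewrite divr_gt0 // ltr0n.
exists (map (dil G (e / M%:R)) (lattice M L)); split.
- by rewrite size_map size_lattice Lsum.
- move=> i j; rewrite size_map => il jl ij; rewrite !(nth_map 0) //.
  rewrite cc_dist_dil // mulrAC EFinM lee_pmul2l //.
  rewrite leNgt; apply/negP => lt_r.
  have := lattice_subgroup step_gt0 Hgrp LW (mem_nth 0 il).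
  have := lattice_subgroup step_gt0 Hgrp LW (mem_nth 0 jl).
  set b := Exp _ => Hb; set a := Exp _ => Ha.
  have /rP : H (a^-1 * b)%g by apply: HM => //; exact: HV.
  rewrite -{1}[1%g](mulVg a) cc_dist_ltrans => /(_ lt_r) ab.
  have {}ab : a = b by rewrite -[b](mulKVg a) ab mulg1.
  have /eqP := (can_inj (@ExpK _ G)) _ _ ab.
  by rewrite nth_uniq // ?(lattice_uniq step_gt0 M LW) // (negPf ij).
- move=> _ z /mapP[h hL ->] zr; apply: (AB (_, _)); split; last exact: rhoP.
  exact: eP.
Qed.

End SeparatedPoints.

(** * Hausdorff measure *)

Section HausdorffLowerBounds.
Context {R : realType} {k : nat}.
Implicit Types (A : set 'rV[R]_k) (x y : 'rV[R]_k).

Lemma eucl_distxx x : eucl_dist x x = 0.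
Proof.
rewrite /eucl_dist big1 ?sqrtr0 // => i _.
by rewrite subrr expr0n.
Qed.

Lemma eucl_dist_ge0 x y : 0 <= eucl_dist x y.
Proof. exact: sqrtr_ge0. Qed.

Lemma eucl_dist_ge_coord x y i : `|x ord0 i - y ord0 i| <= eucl_dist x y.
Proof.
rewrite -sqrtr_sqr /eucl_dist ler_wsqrtr // (bigD1 i) //= lerDl.
by apply: sumr_ge0 => j _; exact: sqr_ge0.
Qed.

Lemma eucl_dist_le_sum x y : eucl_dist x y <= \sum_i `|x ord0 i - y ord0 i|.
Proof.
suff [S0 S2] : 0 <= \sum_i `|x ord0 i - y ord0 i| /\
    \sum_i (x ord0 i - y ord0 i) ^+ 2 <= (\sum_i `|x ord0 i - y ord0 i|) ^+ 2.
  by rewrite -[leRHS]ger0_norm // -sqrtr_sqr ler_wsqrtr.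
elim/big_ind2: _ => [|a b c d [a0 ab] [c0 cd]|i _].
- by rewrite expr0n.
- by split; [exact: addr_ge0 | nra].
- by rewrite real_normK ?num_real.
Qed.

Lemma eucl_diam_ge A x y : A x -> A y -> ((eucl_dist x y)%:E <= eucl_diam A)%E.
Proof. by move=> Ax Ay; apply: ereal_sup_ubound; exists (x, y). Qed.

Lemma diam_pow_ge0 (s : R) A : (0 <= diam_pow s A)%E.
Proof. by rewrite /diam_pow; case: ifP => // _; exact: expeR_ge0. Qed.

(** With s <= 0, a nonempty set of diameter at most 1 costs at least 1, so every cover at scale 1
    does. *)
Lemma hausdorff_gt0_le0 (s : R) A : s <= 0 -> A !=set0 -> (0 < hausdorff s A)%E.
Proof.
move=> s0 [x Ax]; apply: (@lt_le_trans _ _ (hausdorff_pre s 1 A)); last first.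
  by apply: ereal_sup_ubound; exists 1 => //; exact: ltr01.
apply: (@lt_le_trans _ _ 1%E); first exact: lte01.
apply: le_ereal_inf_tmp => _ [E [AE Ediam] <-].
have [i _ Eix] := AE _ Ax.
apply: le_trans (nneseries_lim_ge i.+1 _); last by move=> *; exact: diam_pow_ge0.
rewrite big_nat_recr //= -[leLHS]add0e leeD //.
  by apply: sume_ge0 => *; exact: diam_pow_ge0.
rewrite /diam_pow ifF; last by apply/negbTE/set0P; exists x.
have d0 : (lne (eucl_diam (E i)) <= 0)%E by rewrite lne_le0.
rewrite -expeR0 lee_expeR.
by rewrite -[s]opprK EFinN mulNe -muleN mule_ge0 // ?lee_fin ?oppr_ge0 // oppe_ge0.
Qed.

(* A Hoelder surjection onto [0, 1[ with exponent [s], here the inverse of the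
   parametrization [c], bounds the Hausdorff measure below by Lebesgue measure. *)
Lemma hausdorff_gt0_hoelder (s C : R) A (c : R -> 'rV[R]_k) : 0 < s -> 0 < C ->
    (forall t : R, 0 <= t < 1 -> A (c t)) ->
    (forall t u : R, 0 <= t < 1 -> 0 <= u < 1 ->
       `|t - u| <= C * (eucl_dist (c t) (c u)) `^ s) ->
  (0 < hausdorff s A)%E.
Proof.
move=> s0 C0 Ac hC.
apply: (@lt_le_trans _ _ (hausdorff_pre s 1 A)); last first.
  by apply: ereal_sup_ubound; exists 1 => //; exact: ltr01.
apply: (@lt_le_trans _ _ ((2 * C)^-1)%:E); first by rewrite lte_fin invr_gt0; lra.
apply: le_ereal_inf_tmp => _ [E [AE Ediam] <-].
rewrite -[leLHS]mule1 lee_pdivrMl; last by lra.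
have /choice[I IP] : forall i, exists I : set R, [/\ measurable I,
    (lebesgue_measure I <= (2 * C)%:E * diam_pow s (E i))%E &
    forall t : R, 0 <= t < 1 -> E i (c t) -> I t].
  move=> i.
  have [[t0 [t01 Et0]]|noT] := pselect (exists t, 0 <= t < 1 /\ E i (c t)); last first.
    exists set0; split => //; last by move=> t t01 Et; apply: noT; exists t.
    rewrite measure0 mule_ge0 // ?diam_pow_ge0 // lee_fin; lra.
  have dfin : eucl_diam (E i) \is a fin_num.
    rewrite ge0_fin_numE; first exact: le_lt_trans (Ediam i) (ltry _).
    by apply: le_trans (eucl_diam_ge Et0 Et0); rewrite eucl_distxx.
  pose d := fine (eucl_diam (E i)).
  have dE : eucl_diam (E i) = d%:E by rewrite fineK.
  have d0 : 0 <= d.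
    by rewrite -lee_fin -dE; apply: le_trans (eucl_diam_ge Et0 Et0); rewrite eucl_distxx.
  have pE : diam_pow s (E i) = (d `^ s)%:E.
    rewrite /diam_pow ifF; last by apply/negbTE/set0P; exists (c t0).
    rewrite dE /= /powR; have [->|dn0] := eqVneq d 0.
      by rewrite lexx gt0_muleNy ?lte_fin //= gt_eqF.
    by rewrite leNgt lt_neqAle eq_sym dn0 d0 //=.
  (* By the Hoelder bound, every parameter whose point is in [E i] lies within C d^s of [t0]; this
     gives the factor 2 C. *)
  exists `[t0 - C * d `^ s, t0 + C * d `^ s]%classic; split => //.
    rewrite lebesgue_measure_itv /= pE lte_fin; case: ifP => _.
      by rewrite -EFinD -EFinM lee_fin; lra.
    by rewrite -EFinM lee_fin; have := powR_ge0 d s; nra.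
  move=> t tt Et; rewrite /= in_itv /= -ler_distlC.
  apply: le_trans (hC _ _ t01 tt) _; rewrite ler_wpM2l ?(ltW C0) //.
  apply: ge0_ler_powR; rewrite ?nnegrE ?eucl_dist_ge0 ?(ltW s0) //.
  by rewrite -lee_fin -dE; exact: eucl_diam_ge.
have I01 : `[(0 : R), 1[%classic `<=` \bigcup_i I i.
  move=> t /=; rewrite in_itv /= => t01; have [i _ Ei] := AE _ (Ac _ t01).
  by exists i => //; have [_ _] := IP i; apply.
have mI i : measurable (I i) by have [] := IP i.
have h : (lebesgue_measure (`[0%R, 1%R[%classic : set R) <=
    \sum_(0 <= i <oo) lebesgue_measure (I i))%E.
  exact: measure_sigma_subadditive.
rewrite lebesgue_measure_itv /= lte_fin ltr01 -EFinB subr0 in h.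
apply: le_trans h _; rewrite -nneseriesZl; last by move=> *; exact: diam_pow_ge0.
by apply: lee_nneseries => // i _; have [] := IP i.
Qed.

End HausdorffLowerBounds.

(** * Digits and expansions *)

Section Digits.
Context {R : realType}.
Variable N : nat.
Hypothesis N1 : (1 < N)%N.
Implicit Types t u : R.

(** For t in [0, 1[, the integer written by the first [n] digits in base [N]. Digits are numbered
    from 0, so [digit n] is the last one of prefix n + 1. *)
Definition digit_prefix n t : nat := Num.truncn (t * N%:R ^+ n).
Definition digit n t : nat := (digit_prefix n.+1 t %% N)%N.

Lemma ltn_digit n t : (digit n t < N)%N.
Proof. by rewrite ltn_mod; exact: ltnW. Qed.

Let N0 : 0 < N%:R :> R. Proof. by rewrite ltr0n; exact: ltnW. Qed.

Lemma prefix_itv n t : 0 <= t ->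
  (digit_prefix n t)%:R <= t * N%:R ^+ n < (digit_prefix n t).+1%:R.
Proof. by move=> t0; apply: truncn_itv; rewrite mulr_ge0 // exprn_ge0 // ltW. Qed.

Lemma prefixS n t : 0 <= t -> digit_prefix n.+1 t = (digit_prefix n t * N + digit n t)%N.
Proof.
move=> t0; rewrite /digit [LHS](divn_eq _ N); congr (_ * _ + _)%N.
have /andP[h1 h2] := prefix_itv n t0; have /andP[h3 h4] := prefix_itv n.+1 t0.
apply/eqP; rewrite eqn_leq -ltnS ltn_divLR; last exact: ltnW.
rewrite leq_divRL; last exact: ltnW.
apply/andP; split; [|rewrite -ltnS]; rewrite -(ltr_nat R) natrM.
  apply: le_lt_trans h3 _; rewrite exprSr mulrA ltr_pM2r //.
apply: le_lt_trans h4; rewrite exprSr mulrA ler_pM2r //.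
Qed.

Lemma prefix_dist n t u : 0 <= t -> 0 <= u -> digit_prefix n t = digit_prefix n u ->
  `|t - u| <= N%:R ^- n.
Proof.
move=> t0 u0 E; have := prefix_itv n t0; have := prefix_itv n u0.
have Nn : 0 < N%:R ^+ n :> R by exact: exprn_gt0.
rewrite E -natr1 => /andP[h1 h2] /andP[h3 h4].
rewrite -[leRHS]mul1r ler_pdivlMr // -[X in _ * X]ger0_norm ?(ltW Nn) // -normrM mulrBl.
by rewrite ler_norml; lra.
Qed.

Lemma digits_prefix n t u : 0 <= t < 1 -> 0 <= u < 1 ->
  (forall m, (m < n)%N -> digit m t = digit m u) -> digit_prefix n t = digit_prefix n u.
Proof.
move=> /andP[t0 t1] /andP[u0 u1]; elim: n => [_|n IH h].
  have p0 v : 0 <= v -> v < 1 -> digit_prefix 0 v = 0%N.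
    move=> v0 v1; have /andP[h _] := prefix_itv 0 v0.
    by apply/eqP; rewrite -leqn0 -ltnS -(ltr_nat R); apply: le_lt_trans h _; rewrite mulr1.
  by rewrite !p0.
by rewrite !prefixS // IH ?h // => m mn; apply: h; exact: ltnW.
Qed.

(** If all digits agreed, |t - u| <= N^-n for every n would contradict [t != u]. *)
Lemma first_digit t u : 0 <= t < 1 -> 0 <= u < 1 -> t != u ->
  exists n, [/\ forall m, (m < n)%N -> digit m t = digit m u,
                digit n t != digit n u & `|t - u| <= N%:R ^- n].
Proof.
move=> t01 u01 tu; have [t0 _] := andP t01; have [u0 _] := andP u01.
have ex : exists n, digit n t != digit n u.
  apply: contrapT => /forallNP h.
  have {}h n : digit n t = digit n u by apply/eqP/negP => /negP; exact: h.
  have d0 : 0 < `|t - u| by rewrite normr_gt0 subr_eq0.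
  have [n nd] : exists n, `|t - u|^-1 < n%:R.
    by exists (Num.truncn `|t - u|^-1).+1; have := truncnS_gt `|t - u|^-1.
  have := prefix_dist t0 u0 (digits_prefix t01 u01 (fun m (_ : (m < n)%N) => h m)).
  apply/negP; rewrite -ltNge -[ltRHS]invrK ltf_pV2 ?posrE ?exprn_gt0 ?invr_gt0 //.
  apply: lt_trans nd _; rewrite -natrX ltr_nat; exact: ltn_expl.
have [n nP nmin] := ex_minnP ex.
have agree m : (m < n)%N -> digit m t = digit m u.
  by move=> mn; apply/eqP/negP => /negP /nmin; rewrite leqNgt mn.
exists n; split => //; apply: prefix_dist => //.
exact: digits_prefix.
Qed.

End Digits.

Section Expansion.
Context {R : realType}.
Variables (r B : R).
Hypotheses (r0 : 0 < r) (r1 : r <= 2^-1).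
Implicit Types a b : nat -> R.

Let P a n := \sum_(m < n) r ^+ m * a m.

(** The series of r^m a_m; for the nonnegative digits used here the partial sums increase to this
    supremum. *)
Definition expansion a : R := sup [set P a n | n in setT].

(** The tail is at most B r^n / (1 - r) <= 2 B r^n, as r <= 1/2. The proof shows that these upper
    bounds decrease with n. *)
Lemma expansion_itv a n : (forall m, 0 <= a m <= B) ->
  P a n <= expansion a <= P a n + 2 * B * r ^+ n.
Proof.
move=> aB.
have rn m : 0 < r ^+ m by exact: exprn_gt0.
have PS m : P a m.+1 = P a m + r ^+ m * a m by rewrite /P big_ord_recr.
have Pup m p : (m <= p)%N -> P a m <= P a p.
  elim: p => [|p IH]; first by rewrite leqn0 => /eqP ->.
  rewrite leq_eqVlt => /orP[/eqP -> //|]; rewrite ltnS => /IH h.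
  apply: le_trans h _; rewrite PS lerDl mulr_ge0 ?(ltW (rn p)) //.
  by have /andP[] := aB p.
have Udown m p : (m <= p)%N -> P a p + 2 * B * r ^+ p <= P a m + 2 * B * r ^+ m.
  elim: p => [|p IH]; first by rewrite leqn0 => /eqP ->.
  rewrite leq_eqVlt => /orP[/eqP -> //|]; rewrite ltnS => /IH h.
  apply: le_trans h; rewrite PS exprS.
  have /andP[a0 ab] := aB p; have := rn p; move: (r ^+ p) => q q0.
  have h1 : q * a p <= q * B by rewrite ler_wpM2l // ltW.
  have h2 : B * q * r <= B * q * 2^-1.
    by rewrite ler_wpM2l // mulr_ge0 ?(ltW q0) // (le_trans a0).
  lra.
have B0 : 0 <= B by have /andP[h1 h2] := aB 0; exact: le_trans h2.
have PU m : P a m <= P a n + 2 * B * r ^+ n.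
  have [mn|nm] := leqP m n.
    by apply: le_trans (Pup _ _ mn) _; rewrite lerDl !mulr_ge0 // ltW // rn.
  apply: le_trans (Udown _ _ (ltnW nm)); by rewrite lerDl !mulr_ge0 ?(ltW (rn m)).
have ub : has_sup [set P a n | n in setT].
  split; first by exists (P a 0), 0%N.
  by exists (P a n + 2 * B * r ^+ n) => _ [p _ <-]; exact: PU.
apply/andP; split; first by apply: ub_le_sup; [case: ub | exists n].
by apply: ge_sup; [case: ub | move=> _ [p _ <-]; exact: PU].
Qed.

Lemma expansion_close a b n : (forall m, 0 <= a m <= B) ->
    (forall m, 0 <= b m <= B) -> (forall m, (m < n)%N -> a m = b m) ->
  `|expansion a - expansion b| <= 2 * B * r ^+ n.
Proof.
move=> aB bB ab; have := expansion_itv n aB; have := expansion_itv n bB.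
have -> : P a n = P b n by apply: eq_bigr => i _; rewrite ab.
by move=> /andP[? ?] /andP[? ?]; rewrite ler_norml; lra.
Qed.

(** The first differing digit contributes at least r^n, and the tails differ by at most 2 B r^(n+1)
    <= r^n / 2. *)
Lemma expansion_far a b n : (forall m, 0 <= a m <= B) ->
    (forall m, 0 <= b m <= B) -> (forall m, (m < n)%N -> a m = b m) ->
    1 <= `|a n - b n| -> 4 * B * r <= 1 ->
  r ^+ n / 2 <= `|expansion a - expansion b|.
Proof.
move=> aB bB ab abn Br; have := expansion_itv n.+1 aB; have := expansion_itv n.+1 bB.
have PS c : P c n.+1 = P c n + r ^+ n * c n by rewrite /P big_ord_recr.
have E : P a n = P b n by apply: eq_bigr => i _; rewrite ab.
rewrite !PS E exprS.
have := exprn_gt0 n r0; move: (r ^+ n) => q q0.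
have Brq : 2 * B * (r * q) <= q / 2 by nra.
move=> /andP[h1 h2] /andP[h3 h4].
have : `|q * (a n - b n)| <= `|expansion a - expansion b| + q / 2.
  have -> : q * (a n - b n) = (expansion a - expansion b) +
    (q * (a n - b n) - (expansion a - expansion b)) by ring.
  apply: le_trans (ler_normD _ _) _; rewrite lerD2l ler_norml; lra.
rewrite normrM (gtr0_norm q0) => h.
have : q <= q * `|a n - b n| by rewrite ler_pMr.
lra.
Qed.

End Expansion.

(** * Nested compact sets and Lipschitz extension *)

Lemma nested_compact_nonempty (T : topologicalType) (K : nat -> set T) :
    hausdorff_space T -> (forall n, compact (K n)) ->
    (forall n, K n.+1 `<=` K n) -> (forall n, K n !=set0) ->
  exists p, forall n, K n p.
Proof.
move=> hT Kc KS Kn.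
have Kle m n : (m <= n)%N -> K n `<=` K m.
  elim: n => [|n IH]; first by rewrite leqn0 => /eqP ->.
  rewrite leq_eqVlt => /orP[/eqP -> //|/IH h].
  exact: subset_trans (KS n) h.
have /choice[w wK] : forall n, exists x, K n x by move=> n; have [x] := Kn n; exists x.
have FK n : (w @ \oo) (K n).
  by exists n => // m /= nm; exact: (Kle _ _ nm).
have [p [Kp clp]] := Kc 0%N (w @ \oo) _ (FK 0%N).
exists p => n; apply: (compact_closed hT (Kc n)).
by move=> B pB; exact: clp (FK n) pB.
Qed.

Section McShane.
Context {R : realType} {T : Type}.
Variables (d : T -> T -> R) (L : R) (I : set R) (p : R -> T) (f : R -> R).
Hypotheses (dxx : forall x, d x x = 0) (d_sym : forall x y, d x y = d y x)
  (d_tri : forall x y z, d x z <= d x y + d y z) (L0 : 0 <= L) (I0 : I !=set0)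
  (fL : forall t u, I t -> I u -> f t - f u <= L * d (p t) (p u)).

(** The data live on parameters [t] rather than on points [p t]; [fL] in both orders makes [f t]
    depend on [p t] alone. *)
Definition mcshane (x : T) : R := inf [set f t + L * d (p t) x | t in I].

Let mcshane_inf x : has_inf [set f t + L * d (p t) x | t in I].
Proof.
have [t0 It0] := I0; split; first by exists (f t0 + L * d (p t0) x), t0.
exists (f t0 - L * d (p t0) x) => _ [t It <-].
have := fL It0 It; have := ler_wpM2l L0 (d_tri (p t0) x (p t)).
by rewrite (d_sym x) mulrDr; lra.
Qed.

Lemma mcshane_extends t : I t -> mcshane (p t) = f t.
Proof.
move=> It; apply/eqP; rewrite eq_le; apply/andP; split.
  apply: ge_inf; first by case: (mcshane_inf (p t)).
  by exists t => //; rewrite dxx mulr0 addr0.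
apply: lb_le_inf; first by case: (mcshane_inf (p t)).
by move=> _ [u Iu <-]; have := fL It Iu; rewrite d_sym; lra.
Qed.

Let mcshane_le x y : mcshane x <= mcshane y + L * d x y.
Proof.
rewrite -lerBlDr; apply: lb_le_inf; first by case: (mcshane_inf y).
move=> _ [t It <-]; rewrite lerBlDr.
apply: (@le_trans _ _ (f t + L * d (p t) x)).
  by apply: ge_inf; [case: (mcshane_inf x) | exists t].
by have := ler_wpM2l L0 (d_tri (p t) y x); rewrite mulrDr (d_sym y x); lra.
Qed.

Lemma mcshane_lipschitz x y : `|mcshane x - mcshane y| <= L * d x y.
Proof.
have := mcshane_le x y; have := mcshane_le y x; rewrite (d_sym y x) => h1 h2.
by rewrite ler_norml; lra.
Qed.

End McShane.

Section CCBall.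
Context {R : realType} (G : carnotGroup R).

Definition cc_ball (M : R) : set G := [set a | (cc_dist 1%g a < M%:E)%E].

Lemma cc_ball_open M : cc_open (cc_ball M).
Proof.
move=> a; rewrite /cc_ball /= => aM.
have afin : cc_dist 1%g a \is a fin_num.
  by rewrite ge0_fin_numE ?cc_dist_ge0 // (lt_trans aM) ?ltry.
exists (M - fine (cc_dist 1%g a)); first by rewrite subr_gt0 -lte_fin fineK.
move=> b ab; apply: le_lt_trans (cc_dist_triangle _ a _) _.
by rewrite EFinB fineK // lteBrDl // in ab.
Qed.

Lemma cc_ball_bounded M : cc_bounded (cc_ball M).
Proof.
exists (M + M) => a b aM bM; apply: le_trans (cc_dist_triangle _ 1%g _) _.
by rewrite EFinD (cc_dist_sym a) leeD // ltW.
Qed.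

End CCBall.

(** * The Cantor set in the group *)

Section CantorSet.
Context {R : realType} (G : carnotGroup R).
Notation g := 'rV[R]_(lie_dim G).
Let brL := bracket_lie G.
Variables (m : nat) (E : {linear 'rV[R]_m -> g}) (C : {linear g -> 'rV[R]_m}).
Variables (D rho delta r : R) (S : seq g).
Hypotheses (EC : cancel E C) (CE : cancel C E)
  (Cdil : forall (k : R) y, 0 <= k <= 1 -> `|C (dil G k y)| <= k * `|C y|)
  (cc_fin : forall a b : G, (cc_dist a b < +oo)%E)
  (boxD : forall y, `|C y| <= 1 -> (cc_dist 1%g (Exp y) <= D%:E)%E)
  (Sbox : forall a z, a \in S -> `|C z| <= rho ->
     `|C (bch (step G) (@bracket _ G) a z)| <= 1)
  (Ssep : forall i j, (i < size S)%N -> (j < size S)%N -> i != j ->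
     ((3 * r * D)%:E <= cc_dist (Exp S`_i) (Exp S`_j))%E)
  (r0 : 0 < r) (r1 : r <= 1) (r_rho : r <= rho).
Implicit Types (a b : nat -> nat).

Definition ccd (x y : G) : R := fine (cc_dist x y).

Lemma ccdE x y : (ccd x y)%:E = cc_dist x y.
Proof. by rewrite fineK // ge0_fin_numE ?cc_dist_ge0. Qed.

Lemma ccd_refl x : ccd x x = 0. Proof. by rewrite /ccd cc_dist_refl. Qed.
Lemma ccd_sym x y : ccd x y = ccd y x. Proof. by rewrite /ccd cc_dist_sym. Qed.
Lemma ccd_triangle x y z : ccd x z <= ccd x y + ccd y z.
Proof. by rewrite -lee_fin EFinD !ccdE; exact: cc_dist_triangle. Qed.
Lemma ccd_ltrans x y z : ccd (x * y)%g (x * z)%g = ccd y z.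
Proof. by rewrite /ccd cc_dist_ltrans. Qed.
Lemma ccd_dil (k : R) (x y : g) : 0 < k ->
  ccd (Exp (dil G k x)) (Exp (dil G k y)) = k * ccd (Exp x) (Exp y).
Proof.
by move=> k0; apply: EFin_inj; rewrite EFinM !ccdE cc_dist_dil.
Qed.
Lemma ccd_box y : `|C y| <= 1 -> ccd 1%g (Exp y) <= D.
Proof. by move=> /boxD; rewrite -ccdE lee_fin. Qed.

(** Group analogue of the partial sums of [expansion]: the digit [a i] selects a point of [S],
    dilated by r^i. *)
Fixpoint cell_base (a : nat -> nat) n : G :=
  if n is n'.+1 then (cell_base a n' * Exp (dil G (r ^+ n') S`_(a n'))%R)%g else 1%g.

Definition cell a n : set G :=
  [set x | exists2 z, `|C z| <= 1 & x = (cell_base a n * Exp (dil G (r ^+ n) z)%R)%g].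

Lemma cell_base_agree a b n : (forall i, (i < n)%N -> a i = b i) ->
  cell_base a n = cell_base b n.
Proof.
elim: n => //= n IH ab; rewrite ab // IH // => i ni; apply: ab; exact: ltnW.
Qed.

(** At scale 1 this is [Sbox]: a point of [S] times a box of size r <= rho stays in the unit box.
    Dilation by r^n and left translation do the rest. *)
Lemma cellS a n : (a n < size S)%N -> cell a n.+1 `<=` cell a n.
Proof.
move=> an _ [z z1 ->]; exists (bch (step G) (@bracket _ G) S`_(a n) (dil G r z)).
  apply: Sbox; first exact: mem_nth.
  apply: le_trans (Cdil _ _) _; first by rewrite ltW.
  by apply: le_trans r_rho; rewrite -[leRHS]mulr1 ler_wpM2l // ltW.
rewrite /= -mulgA ExpM; congr (_ * Exp _)%g.
have -> : dil G (r ^+ n) (bch (step G) (@bracket _ G) S`_(a n) (dil G r z)) =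
    bch (step G) (@bracket _ G) (dil G (r ^+ n) S`_(a n)) (dil G (r ^+ n) (dil G r z)).
  by apply: bch_morph => x y; exact: dil_bracket.
by rewrite dilM exprSr.
Qed.

(** Compactness is taken in the chart [Log], where each cell is the continuous image of a closed
    ball of 'rV[R]_m. *)
Lemma cell_point a : (forall n, (a n < size S)%N) -> exists x, forall n, cell a n x.
Proof.
move=> aS; pose K n : set g := [set Log x | x in cell a n].
have [p Kp] : exists p, forall n, K n p.
  apply: nested_compact_nonempty => //.
  - move=> n; have Kc : compact [set c : 'rV[R]_m | `|c| <= 1].
      apply: bounded_closed_compact.
        exists 1; split; first exact: num_real.
        by move=> M M1 c /= c1; apply: le_trans c1 (ltW M1).
      apply: (@closed_comp _ _ (fun c : 'rV[R]_m => `|c|) [set x | x <= 1]).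
        by move=> c _; exact: norm_continuous.
      exact: closed_le.
    have -> : K n = [set bch (step G) (@bracket _ G) (Log (cell_base a n))
        (dil G (r ^+ n) (E c)) | c in [set c : 'rV[R]_m | `|c| <= 1]].
      have LogM (x : G) (y : g) :
          Log (x * Exp y)%g = bch (step G) (@bracket _ G) (Log x) y.
        by rewrite -{1}(LogK x) ExpM ExpK.
      apply/seteqP; split => [_ [_ [z z1 ->] <-]|_ [c c1 <-]].
        by exists (C z) => //=; rewrite CE LogM.
      exists (cell_base a n * Exp (dil G (r ^+ n) (E c))%R)%g; last exact: LogM.
      by exists (E c) => //; rewrite EC.
    apply: continuous_compact => //; apply: continuous_subspaceT => c.
    have brB : bilinear_map (@bracket R G) by case: brL.
    apply: (@bch_cvg _ _ _ _ _ (nbhs c) _ (fun=> Log (cell_base a n))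
      (fun c => dil G (r ^+ n) (E c))) => //; first exact: cvg_cst.
    exact: (@linear_row_continuous _ _ _ (dil G (r ^+ n) \o E)).
  - move=> n _ [x xn <-]; exists x => //; exact: (cellS (aS n) xn).
  - move=> n; exists (Log (cell_base a n)), (cell_base a n) => //.
    by exists 0; rewrite !linear0 ?normr0 // Exp0 mulg1.
exists (Exp p) => n; have [x xn <-] := Kp n; by rewrite LogK.
Qed.

(** The centres are 3 r^(n+1) D apart and each cell has radius at most r^(n+1) D about its centre,
    which leaves one r^(n+1) D. *)
Lemma cell_separated a b x y n :
    (forall i, (i < n)%N -> a i = b i) -> (a n < size S)%N -> (b n < size S)%N ->
    a n != b n -> cell a n.+1 x -> cell b n.+1 y ->
  r ^+ n.+1 * D <= ccd x y.
Proof.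
move=> ab aS bS abn [z z1 ->] [w w1 ->] /=.
rewrite (cell_base_agree ab) -!mulgA ccd_ltrans.
set P := Exp (dil G _ S`_(a n)); set Q := Exp (dil G _ S`_(b n)).
have rn k : 0 < r ^+ k by exact: exprn_gt0.
have box v : `|C v| <= 1 -> ccd 1%g (Exp (dil G (r ^+ n.+1) v)) <= r ^+ n.+1 * D.
  move=> v1; rewrite -Exp0 -(linear0 (dil G (r ^+ n.+1))) ccd_dil // Exp0.
  by rewrite ler_wpM2l ?(ltW (rn _)) // ccd_box.
have PQ : 3 * (r ^+ n.+1 * D) <= ccd P Q.
  rewrite ccd_dil // exprS.
  have -> : 3 * (r * r ^+ n * D) = r ^+ n * (3 * r * D) by ring.
  by rewrite ler_wpM2l ?(ltW (rn n)) // -lee_fin ccdE Ssep.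
have := ccd_triangle P (P * Exp (dil G (r ^+ n.+1) z)%R)%g Q.
have := ccd_triangle (P * Exp (dil G (r ^+ n.+1) z)%R)%g
  (Q * Exp (dil G (r ^+ n.+1) w)%R)%g Q.
have boxP (p : G) v : `|C v| <= 1 ->
    ccd p (p * Exp (dil G (r ^+ n.+1) v)%R)%g <= r ^+ n.+1 * D.
  by move=> v1; rewrite -{1}[p]mulg1 ccd_ltrans box.
have := boxP P z z1; have := boxP Q w w1.
rewrite (ccd_sym Q); lra.
Qed.

End CantorSet.

(** * Matching the digits and choosing the ratio *)

(** Translates one group digit below M^k into the [k] coordinates of a corner of the Euclidean
    cube. *)
Lemma digit_vectors (M k : nat) : (0 < M)%N -> exists v : nat -> 'I_k -> nat,
  (forall a i, (v a i < M)%N) /\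
  (forall a b, (a < M ^ k)%N -> (b < M ^ k)%N -> a != b -> exists i, v a i != v b i).
Proof.
case: M => // M _.
pose F := {ffun 'I_k -> 'I_M.+1}; pose d : F := [ffun=> ord0].
exists (fun a i => nth d (enum F) a i); split => [a i|a b]; first exact: ltn_ord.
have -> : (M.+1 ^ k)%N = size (enum F) by rewrite -cardE card_ffun !card_ord.
move=> aF bF ab; apply: contrapT => /forallNP h.
move: ab; rewrite -(nth_uniq d aF bF (enum_uniq _)) => /eqP; apply.
by apply/ffunP => i; apply/val_inj/eqP/negP => /negP; exact: h.
Qed.

Section CantorRatio.
Context {R : realType}.

Lemma cantor_ratio (k : nat) (eps rho D delta : R) :
    0 < eps -> 0 < k%:R - eps -> 0 < rho -> 0 < D -> 0 < delta ->
  exists (M : nat) (r : R), [/\ (1 < M)%N, 0 < r, r <= 2^-1 /\ r <= rho,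
    3 * r * D <= delta / M%:R &
    4 * M%:R * r <= 1 /\ 1 <= (M ^ k)%N%:R * r `^ (k%:R - eps)].
Proof.
move=> eps0 s0 rho0 D0 delta0; set s := k%:R - eps.
(* One summand per requirement: 4 M r <= 1 (and r <= 1/2), r <= rho, and the separation 3 r D <=
   delta / M. *)
pose A := 4 + rho^-1 + 3 * D / delta.
have h1 : 0 < rho^-1 by rewrite invr_gt0.
have h2 : 0 < 3 * D / delta by rewrite divr_gt0 //; lra.
have A0 : 0 < A by rewrite /A; lra.
pose B := A `^ (s / eps).
(* With r = 1/(A M), M^k r^s equals M^eps / A^s, which is at least 1 once M >= A^(s/eps) = [B]. The
   shift by 2 also gives M >= 2. *)
pose M := (Num.truncn B).+2.
have MB : B <= M%:R.
  by apply/ltW/(lt_trans (truncnS_gt B)); rewrite ltr_nat.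
have M0 : 0 < M%:R :> R by rewrite ltr0n.
have M2 : 2 <= M%:R :> R by rewrite ler_nat.
exists M, (A * M%:R)^-1.
have AM0 : 0 < A * M%:R by exact: mulr_gt0.
have AM : A <= A * M%:R by rewrite ler_peMr ?(ltW A0) //; lra.
split => //.
- by rewrite invr_gt0.
- have rA : (A * M%:R)^-1 <= A^-1 by rewrite lef_pV2.
  split; apply: le_trans rA _.
    by rewrite lef_pV2 ?posrE // /A; lra.
  by rewrite -[leRHS]invrK lef_pV2 ?posrE // /A; lra.
- rewrite invfM mulrA mulrAC ler_pM2r ?invr_gt0 //.
  rewrite mulrAC ler_pdivrMr // /A !mulrDr mulrCA mulfV ?gt_eqF // mulr1.
  have : 0 <= delta * 4 by lra.
  have : 0 <= delta * rho^-1 by rewrite mulr_ge0 // ltW.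
  lra.
- split.
    rewrite ler_pdivrMr // mul1r ler_pM2r // /A; lra.
  rewrite -powR_inv1 ?(ltW AM0) // powRAC powR_inv1 ?powR_ge0 //.
  rewrite ler_pdivlMr ?powR_gt0 // mul1r natrX -powR_mulrn ?(ltW M0) //.
  rewrite (_ : k%:R = s + eps); last by rewrite subrK.
  rewrite powRM ?(ltW A0) ?(ltW M0) //.
  rewrite (@powRD _ M%:R s eps); last first.
    by apply/implyP => _; exact: lt0r_neq0.
  rewrite mulrC ler_pM2l ?powR_gt0 //.
  have -> : A `^ s = B `^ eps by rewrite /B -powRrM divfK // gt_eqF.
  by apply: ge0_ler_powR; rewrite ?nnegrE ?powR_ge0 ?(ltW eps0) ?(ltW M0).
Qed.

End CantorRatio.

Theorem theorem3p2 (R : realType) (G : carnotGroup R) (eps : R) :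
  discretizable G -> 0 < eps ->
  exists (U : set G) (F : G -> 'rV[R]_(hom_dim G)),
    [/\ cc_open U, cc_bounded U, cc_lipschitz_on U F &
        (0 < hausdorff ((hom_dim G)%:R - eps) (F @` U))%E].
Proof.
move=> Gdisc eps0; set s := (hom_dim G)%:R - eps.
(* For s <= 0 a constant map suffices. For s > 0 both the step and the homogeneous dimension are
   positive. *)
have [s0|s0] := leP s 0.
  exists (cc_ball 1), (fun=> 0); split.
  - exact: cc_ball_open.
  - exact: cc_ball_bounded.
  - by exists 0 => // a b _ _; rewrite eucl_distxx mul0e.
  - apply: hausdorff_gt0_le0 => //; exists 0, 1%g => //.
    by rewrite /cc_ball /= cc_dist_refl lte_fin.
have step_gt0 : (0 < step G)%N.
  rewrite lt0n; apply/eqP => st0; move: s0.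
  by rewrite /s /hom_dim st0 big_geq // sub0r oppr_gt0 ltNge ltW.
have [m [E [C [D [rho [delta [[EC CE] Cdil fin [D0 rho0 delta0 boxD pts]]]]]]]] :=
  separated_points step_gt0 Gdisc.
have [M [r [M1 r0 [r2 rrho] rD [rM Nrs]]]] := cantor_ratio eps0 s0 rho0 D0 delta0.
have M0 : (0 < M)%N by exact: ltnW.
have [S [Ssize Ssep Sbox]] := pts M M0.
have k0 : (0 < hom_dim G)%N.
  by rewrite lt0n; apply/eqP => k0; move: s0; rewrite /s k0 sub0r oppr_gt0 ltNge ltW.
pose N := (M ^ hom_dim G)%N.
have N1 : (1 < N)%N by rewrite -(exp1n (hom_dim G)) ltn_exp2r.
have [v [vM vinj]] := digit_vectors (hom_dim G) M0.
have {}Ssep i j : (i < size S)%N -> (j < size S)%N -> i != j ->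
    ((3 * r * D)%:E <= cc_dist (Exp S`_i) (Exp S`_j))%E.
  by move=> iS jS ij; apply: le_trans (Ssep i j iS jS ij); rewrite lee_fin.
have r1 : r <= 1 by apply: le_trans r2 _; rewrite invf_le1 // ler1n.
have digS (t : R) n : (digit N n t < size S)%N by rewrite Ssize ltn_digit.
have /choice[p pP] : forall t : R, exists x, forall n, cell C r S (digit N ^~ t) n x.
  by move=> t; exact: (cell_point EC CE Cdil Sbox).
pose a (t : R) (i : 'I_(hom_dim G)) n : R := (v (digit N n t) i)%:R.
pose c (t : R) := \row_i expansion r (a t i).
have aM t i n : 0 <= a t i n <= M%:R by rewrite ler0n ler_nat ltnW.
pose I : set R := [set t | 0 <= t < 1].
(* Ratio of the Euclidean upper bound 2 M r^n to the group lower bound r^(n+1) D at the first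
   differing digit [n]. *)
pose L := 2 * M%:R / (r * D).
have L0 : 0 <= L by apply: divr_ge0; apply: mulr_ge0; rewrite ?ler0n // ltW.
have cL i t u : I t -> I u ->
    expansion r (a t i) - expansion r (a u i) <= L * ccd (p t) (p u).
  move=> t01 u01; have [->|tu] := eqVneq t u.
    by rewrite subrr mulr_ge0 // /ccd fine_ge0 // cc_dist_ge0.
  have [n [agree dn _]] := first_digit N1 t01 u01 tu.
  have far := cell_separated fin boxD Ssep r0 agree (digS t n) (digS u n) dn
    (pP t n.+1) (pP u n.+1).
  have := @expansion_close _ r M%:R r0 r2 (a t i) (a u i) n (aM t i) (aM u i).
  move=> /(_ _)/le_trans close; apply: le_trans (ler_norm _) _; apply: close.
    by move=> j jn; rewrite /a agree.
  apply: (@le_trans _ _ (L * (r ^+ n.+1 * D))); last by rewrite ler_wpM2l.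
  by rewrite /L exprS le_eqVlt; apply/orP; left; apply/eqP; field; rewrite ?gt_eqF.
pose F (x : G) := \row_i mcshane (@ccd R G) L I p (fun t => expansion r (a t i)) x.
have I0 : I !=set0 by exists 0; rewrite /I /= lexx ltr01.
have Fp t : I t -> F (p t) = c t.
  move=> It; apply/rowP => i; rewrite !mxE.
  by apply: mcshane_extends => //; [exact: ccd_refl | exact: ccd_sym |
    exact: ccd_triangle | exact: cL].
have Flip x y i : `|F x ord0 i - F y ord0 i| <= L * ccd x y.
  rewrite !mxE; apply: mcshane_lipschitz => //; [exact: ccd_sym |
    exact: ccd_triangle | exact: cL].
(* The cell of level 0 is the unit box, at distance at most [D] from 1; the 1 makes the inequality
   strict. *)
exists (cc_ball (D + 1)), F; split.
- exact: cc_ball_open.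
- exact: cc_ball_bounded.
- exists ((hom_dim G)%:R * L); first by rewrite mulr_ge0.
  move=> x y _ _; rewrite -(ccdE fin) -EFinM lee_fin.
  apply: le_trans (eucl_dist_le_sum _ _) _.
  apply: le_trans (ler_sum _ (fun i _ => Flip x y i)) _.
  by rewrite sumr_const card_ord -[leRHS]mulrA mulr_natl.
(* The factor 2^s cancels the 1/2 in the separation r^n / 2; what remains is N^-n <= (r^s)^n, which
   is N r^s >= 1. *)
apply: (@hausdorff_gt0_hoelder _ _ s (2 `^ s) _ c s0); first exact: powR_gt0.
  move=> t t01; exists (p t); last exact: Fp.
  have [z z1 ->] := pP t 0%N; rewrite /cc_ball /= mul1g expr0 dil1.
  by apply: le_lt_trans (boxD _ z1) _; rewrite lte_fin ltrDl.
move=> t u t01 u01; have [->|tu] := eqVneq t u.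
  by rewrite subrr normr0 mulr_ge0 // powR_ge0.
have [n [agree dn tun]] := first_digit N1 t01 u01 tu.
have [i vi] := vinj _ _ (ltn_digit N1 n t) (ltn_digit N1 n u) dn.
have far : r ^+ n / 2 <= eucl_dist (c t) (c u).
  apply: le_trans (eucl_dist_ge_coord _ _ i); rewrite !mxE.
  apply: (@expansion_far _ r M%:R r0 r2 (a t i) (a u i) n) => //.
    by move=> j jn; rewrite /a agree.
  move: vi; rewrite /a neq_ltn => /orP[] h.
    rewrite distrC ger0_norm ?subr_ge0 ?ler_nat ?(ltnW h) // lerBrDl.
    by rewrite natr1 ler_nat.
  rewrite ger0_norm ?subr_ge0 ?ler_nat ?(ltnW h) // lerBrDl.
  by rewrite natr1 ler_nat.
apply: le_trans tun _.
have rn : 0 < r ^+ n by exact: exprn_gt0.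
apply: (@le_trans _ _ (2 `^ s * (r ^+ n / 2) `^ s)); last first.
  rewrite ler_wpM2l ?powR_ge0 //; apply: ge0_ler_powR => //; rewrite ?nnegrE ?(ltW s0) //.
  - by rewrite divr_ge0 // ltW.
  - exact: eucl_dist_ge0.
rewrite -powRM //; last by rewrite divr_ge0 // ltW.
rewrite mulrC divfK // -powR_mulrn ?(ltW r0) // powRAC powR_mulrn ?powR_ge0 //.
have Nn0 : 0 < N%:R ^+ n :> R by rewrite exprn_gt0 // ltr0n ltnW.
rewrite -[leLHS]mul1r ler_pdivrMr // -exprMn mulrC.
exact: exprn_ege1.
Qed.
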